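(* Let $\Pi'=\Pi_1'\sqcup\Pi_2'$ be the simple roots of $\Delta'$, $\gamma=\tau_2\tau_1$ the Coxeter element and $d_1,\dots,d_{2s}$ the singular directions, chosen as described in the context (so that $\gamma=\mathrm{Ad}\,P_0|_{\mathfrak h'}$ and $\Delta'_+=\mathcal R(d_1)\sqcup\cdots\sqcup\mathcal R(d_s)$). For $t\in W'$ let $\Lambda(t)=t^{-1}\Delta'_-\cap\Delta'_+$ be the set of positive roots which become negative upon applying $t$. Then (i) $\mathcal R(d_1)\sqcup\mathcal R(d_2)=\Lambda(\gamma^{-1})=\Pi_2'\sqcup\gamma(-\Pi_1')$, and (ii) $\mathcal R(d_{s-1})\sqcup\mathcal R(d_s)=\Lambda(\gamma)=\Pi_1'\sqcup\gamma^{-1}(-\Pi_2')$.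
   Context: Let $G$ be a complex simple Lie group of rank $l>1$ with Lie algebra $\mathfrak g$, Cartan subalgebra $\mathfrak h$, simple roots $\alpha_1,\dots,\alpha_l$, highest root $\psi=\sum_{i=1}^l q_i\alpha_i$, $\alpha_0=-\psi$, Coxeter number $s=1+\sum_{i=1}^l q_i$, and nonzero root vectors $e_\alpha\in\mathfrak g_\alpha$. Let $\epsilon_1,\dots,\epsilon_l\in\mathfrak h$ satisfy $\alpha_i(\epsilon_j)=\delta_{ij}$, $x_0=\sum_{i=1}^l\epsilon_i$, and $P_0=\exp(2\pi\sqrt{-1}\,x_0/s)\in G$. Let $E_+=\sum_{i=0}^l c_i^+e_{\alpha_i}$ with all $c_i^+\in\mathbb C^*$; it is regular semisimple (Kostant). Let $\mathfrak h'$ be the Cartan subalgebra of $\mathfrak g$ centralizing $E_+$, $\Delta'$ the roots with respect to $\mathfrak h'$, $W'$ their Weyl group. $\mathrm{Ad}\,P_0$ preserves $\mathfrak h'$ and $\delta=\mathrm{Ad}\,P_0|_{\mathfrak h'}\in W'$ is a Coxeter element; it acts on $\Delta'$ by $\delta(\beta)=\beta\circ\mathrm{Ad}(P_0)^{-1}$. Singular directions: the rays in $\mathbb C$ from $0$ through the points $\beta(-E_+)$, $\beta\in\Delta'$. There are $2s$ of them, equally spaced, labelled $d_1,\dots,d_{2s}$ clockwise. $\mathcal R(d_i)$ is the set of $\beta\in\Delta'$ such that $\beta(-E_+)$ lies on $d_i$. Bipartite Coxeter elements: any set of simple roots $\Pi'$ of $\Delta'$ has a partition $\Pi'=\Pi_1'\sqcup\Pi_2'$,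 unique up to the labelling of the two parts, such that the roots in each part are mutually orthogonal. Put $\tau_k=\prod_{\beta\in\Pi'_k}R_\beta$ ($k=1,2$), where $R_\beta$ is the reflection in $\beta$, and $\gamma=\tau_2\tau_1$. Choose $\Pi'$ and the labelling of the partition so that $\gamma=\delta$, and the initial direction $d_1$ so that the positive system $\Delta'_+$ with simple roots $\Pi'$ is $\Delta'_+=\mathcal R(d_1)\sqcup\cdots\sqcup\mathcal R(d_s)$ (such choices are possible). $\Delta'_-=-\Delta'_+$. *)

(* Defs.v *)
From mathcomp Require Import all_boot all_order all_algebra.
From mathcomp Require Import complex.
From mathcomp Require Import all_classical all_reals all_analysis.
Import Order.TTheory GRing.Theory Num.Theory.
Import numFieldNormedType.Exports.

Set Implicit Arguments.
Unset Strict Implicit.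
Unset Printing Implicit Defensive.

Local Open Scope classical_set_scope.
Local Open Scope ring_scope.

(* [ad X Y] is the Lie bracket [X, Y]; its type makes it bilinear. *)
Record lieAlgebra (K : fieldType) := LieAlgebra {
  lie_sort :> vectType K;
  ad : 'Hom(lie_sort, 'End(lie_sort));
  ad_alternating : forall X, ad X X = 0;
  ad_jacobi : forall X Y Z, ad X (ad Y Z) + ad Y (ad Z X) + ad Z (ad X Y) = 0
}.
Arguments ad {K g} : rename.

Section LieAlgebra.
Variables (K : fieldType) (g : lieAlgebra K).

Definition lie_ideal (I : {vspace g}) := forall X Y : g, Y \in I -> ad X Y \in I.

Definition lie_simple :=
  ~ (forall X Y : g, ad X Y = 0) /\
  (forall I : {vspace g}, lie_ideal I -> I = 0%VS \/ I = fullv).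

Definition diagonalizable_lfun (f : 'End(g)) :=
  exists2 b : seq g, basis_of fullv b & {in b, forall v, exists c : K, f v = c *: v}.

Definition lie_abelian (H : {vspace g}) := {in H &, forall X Y, ad X Y = 0}.

(* For semisimple Lie algebras over an algebraically closed field of
   characteristic 0: a maximal abelian subalgebra all of whose elements are
   ad-semisimple. *)
Definition cartan_subalgebra (H : {vspace g}) :=
  [/\ lie_abelian H,
      forall A : {vspace g}, lie_abelian A -> (H <= A)%VS -> A = H &
      {in H, forall X, diagonalizable_lfun (ad X)}].

Definition lfun_trace (f : 'End(g)) : K :=
  \tr (passmx.mxof (vbasis fullv) (vbasis fullv) f).

Definition killing (X Y : g) : K := lfun_trace (ad X \o ad Y)%VF.

Section Roots.
Variable h : {vspace g}.

Definition dual_space := 'Hom(subvs_of h, K^o).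

Definition in_root_space (a : dual_space) (X : g) :=
  forall H : subvs_of h, ad (vsval H) X = (a H : K) *: X.

Definition is_root (a : dual_space) :=
  a != 0 /\ exists2 X : g, X != 0 & in_root_space a X.

Definition nonneg_comb (S : seq dual_space) (b : dual_space) :=
  exists n : dual_space -> nat, b = \sum_(a <- S) a *+ n a.

Definition simple_roots (S : seq dual_space) :=
  [/\ free S, {in S, forall a, is_root a} &
      forall b, is_root b -> nonneg_comb S b \/ nonneg_comb S (- b)].

Definition positive_roots (S : seq dual_space) : set dual_space :=
  [set b | is_root b /\ nonneg_comb S b].

Definition highest_root (S : seq dual_space) (p : dual_space) :=
  is_root p /\ forall b, is_root b -> nonneg_comb S (p - b).

(* The isomorphism h -> h^* given by the Killing form, which is nondegenerate
   on a Cartan subalgebra h. *)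
Definition killing_dual : 'Hom(subvs_of h, dual_space) :=
  linfun (fun H : subvs_of h =>
    linfun (fun H' : subvs_of h => killing (vsval H) (vsval H') : K^o)).

Definition dual_form (a b : dual_space) : K := a ((killing_dual^-1)%VF b).

Definition mutually_orthogonal (S : seq dual_space) :=
  {in S &, forall a b, a != b -> dual_form a b = 0}.

Definition reflection (b : dual_space) : 'End(dual_space) :=
  linfun (fun a => a - (2%:R * dual_form a b / dual_form b b) *: b).

(* For mutually orthogonal S the reflections commute, so that the order of the
   composition does not matter. *)
Definition reflections_prod (S : seq dual_space) : 'End(dual_space) :=
  \big[(fun f f' => f \o f')%VF / \1%VF]_(b <- S) reflection b.

End Roots.
End LieAlgebra.

Definition coxeter_number (l : nat) (q : 'I_l -> nat) : nat :=
  (1 + \sum_(i < l) q i)%N.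

(* alpha_0 = - psi, followed by alpha_1, ..., alpha_l *)
Definition extended_roots (V : zmodType) (l : nat) (alpha : l.-tuple V) (psi : V)
  (i : 'I_l.+1) : V :=
  if unlift ord0 i is Some j then tnth alpha j else - psi.

Section Complex.
Variable R : realType.
Local Notation C := (R[i]).

(* F v = \sum_n f^n v / n! for all v, the convergence in the finite-dimensional
   space being tested on all linear functionals. *)
Definition is_lfun_exp (V : vectType C) (f F : 'End(V)) :=
  forall (phi : 'Hom(V, C^o)) (v : V),
    (fun n : nat => phi (\sum_(k < n) (k`!%:R : C)^-1 *: iter k f v) : C^o)
      @ \oo --> (phi (F v) : C^o).

(* The part of the structure of a complex Lie group with Lie algebra g that
   is used: the underlying group, the exponential map and the adjoint
   representation. Every such Lie group provides an instance. *)
Record lieGroup (g : lieAlgebra C) := LieGroup {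
  lie_group_sort :> groupType;
  lie_exp : g -> lie_group_sort;
  Ad : lie_group_sort -> 'End(g);
  lie_expD : forall (X : g) (a b : C),
    lie_exp ((a + b) *: X) = (lie_exp (a *: X) * lie_exp (b *: X))%g;
  Ad1 : Ad 1%g = \1%VF;
  AdM : forall x y, Ad (x * y)%g = (Ad x \o Ad y)%VF;
  Ad_bracket : forall x X Y, Ad x (ad X Y) = ad (Ad x X) (Ad x Y);
  Ad_exp : forall X, is_lfun_exp (ad X) (Ad (lie_exp X))
}.

Definition expi (t : R) : C := Complex (cos t) (sin t).

Definition ray (z : C) : set C :=
  [set w | exists2 r : R, 0 <= r & w = real_complex R r * z].

(* d_1, ..., d_N are the distinct elements of D, in clockwise order. *)
Definition clockwise_labelling (D : set (set C)) (N : nat) (d : nat -> set C) :=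
  exists theta : nat -> R,
    [/\ D = d @` [set i | (1 <= i <= N)%N],
        forall i, (1 <= i <= N)%N -> d i = ray (expi (theta i)),
        forall i j, (1 <= i)%N -> (i < j)%N -> (j <= N)%N -> theta j < theta i &
        theta 1%N - theta N < 2 * pi].

Section SingularDirections.
Variables (g : lieAlgebra C) (h : {vspace g}).

(* E is meant to lie in h, and in lfun_restr A is meant to map h into
   itself, so that vsproj is only a change of type. *)
Definition singular_directions (E : g) : set (set C) :=
  [set ray (b (vsproj h (- E))) | b in @is_root _ g h].

Definition roots_on (E : g) (d : set C) : set (dual_space h) :=
  [set b | is_root b /\ d (b (vsproj h (- E)))].

Definition lfun_restr (A : 'End(g)) : 'End(subvs_of h) :=
  linfun (fun H : subvs_of h => vsproj h (A (vsval H))).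

(* action on h^* of an automorphism of h *)
Definition dual_action (t : 'End(subvs_of h)) (b : dual_space h) : dual_space h :=
  (b \o t^-1)%VF.

Definition Lambda (P : set (dual_space h)) (t : 'End(dual_space h)) :
    set (dual_space h) :=
  (t @^-1` [set - b | b in P]) `&` P.

End SingularDirections.
End Complex.

Arguments lie_exp {R g G} : rename.
Arguments Ad {R g G} : rename.
Arguments roots_on {R g} h E d.

Definition disjoint_union (T : Type) (A B U : set T) :=
  A `&` B = set0 /\ U = A `|` B.

(* Main.v *)
(* Ad P0 rotates E_+ by zeta = exp(2 i pi / s), because alpha_0, ..., alpha_l
   all take the value 1 modulo s at x_0.  Hence gamma rotates the values of the
   roots at -E_+ clockwise by 2 pi / s.  The 2s directions are permuted by this
   rotation; enumerating them clockwise for ever, the rotation becomes an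
   increasing map f of the natural numbers that commutes with the shift by 2s
   and whose s-th iterate is this shift, so f is the shift by 2.  Since E_+ is
   regular and the positive roots are those on d_1, ..., d_s, this gives the
   description of Lambda(gamma^-1) and Lambda(gamma) by directions.

   The description by simple roots only uses that the reflections in mutually
   orthogonal simple roots permute the positive roots outside of these simple
   roots.  This rests on three facts about the Cartan subalgebra h': the
   Killing form is nondegenerate on it, root reflections preserve the roots,
   and the only natural multiple of a root that is a root is itself.  All
   three follow from the analysis of root strings. *)
From HB Require Import structures.
Require Import Defs.
From mathcomp Require Import all_boot all_order all_algebra.
From mathcomp Require Import complex.
From mathcomp Require Import all_classical all_reals all_analysis.
From mathcomp Require Import ring lra zify.
Import Order.TTheory GRing.Theory Num.Theory.
Import numFieldNormedType.Exports.

Set Implicit Arguments.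
Unset Strict Implicit.
Unset Printing Implicit Defensive.

Local Open Scope classical_set_scope.
Local Open Scope ring_scope.

(** * Trace and Killing form *)

(** The definitions apply [linfun] to bare functions, so linearity becomes a side condition to
    discharge at each evaluation. *)
Lemma linfunE (K : fieldType) (U V : vectType K) (f : U -> V) :
  linear f -> linfun f =1 f.
Proof.
move=> lf; pose fL : {linear U -> V} :=
  HB.pack f (GRing.isLinear.Build K U V _ f lf).
exact: (lfunE fL).
Qed.

Section Trace.
Variables (K : fieldType) (g : lieAlgebra K).
Implicit Types f : 'End(g).
Import passmx.

Lemma lfun_trace_basis (b : (\dim {:g}).-tuple g) f : basis_of fullv b ->
  lfun_trace f = \sum_i coord b i (f b`_i).
Proof.
move=> bP; have eP := vbasisP {:g}.
transitivity (\tr (mxof b b f)); last first.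
  by apply: eq_bigr => i _; rewrite !mxE /= vecof_delta.
(* The identities inserted on both sides are read as changes of basis, which cancel by cyclicity of
   the trace. *)
rewrite /lfun_trace -[f in LHS]comp_lfun1r -[f in LHS]comp_lfun1l.
rewrite (mxof_comp _ _ bP) (mxof_comp _ _ bP) mulmxA mxtrace_mulC !mulmxA.
by rewrite -(mxof_comp _ _ eP) comp_lfun1l mxof1 ?(basis_free bP)// mul1mx.
Qed.

Lemma lfun_traceC f1 f2 : lfun_trace (f1 \o f2)%VF = lfun_trace (f2 \o f1)%VF.
Proof.
have eP := vbasisP {:g}.
by rewrite /lfun_trace !(mxof_comp _ _ eP) mxtrace_mulC.
Qed.

Lemma lfun_trace_linear : linear_for *%R (@lfun_trace K g).
Proof. by move=> a f1 f2; rewrite /lfun_trace linearP mxtraceD mxtraceZ. Qed.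

Lemma lfun_traceB f1 f2 : lfun_trace (f1 - f2) = lfun_trace f1 - lfun_trace f2.
Proof. by rewrite addrC -scaleN1r lfun_trace_linear mulN1r addrC. Qed.

Lemma lfun_traceZ c f : lfun_trace (c *: f) = c * lfun_trace f.
Proof. by rewrite /lfun_trace linearZ mxtraceZ. Qed.

Lemma adC (X Y : g) : ad X Y = - ad Y X.
Proof.
apply/eqP; rewrite -addr_eq0.
have := ad_alternating (X + Y).
rewrite !linearD /= !add_lfunE !ad_alternating add0r addr0.
by move=> /eqP; rewrite addrC.
Qed.

Lemma ad_ad (X Y Z : g) : ad (ad X Y) Z = ad X (ad Y Z) - ad Y (ad X Z).
Proof.
rewrite adC; apply/eqP; rewrite eq_sym -subr_eq0 opprK; apply/eqP.
by rewrite -[RHS](ad_jacobi X Y Z) [ad Z X]adC linearN.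
Qed.

Lemma killingC (X Y : g) : killing X Y = killing Y X.
Proof. exact: lfun_traceC. Qed.

(** Both sides expand by the Jacobi identity. The first terms coincide; the second ones, the traces
    of ad Y ad X ad Z and ad X ad Z ad Y, agree by cyclicity. *)
Lemma killing_ad (X Y Z : g) : killing (ad X Y) Z = killing X (ad Y Z).
Proof.
rewrite /killing.
have -> : (ad (ad X Y) \o ad Z)%VF =
    (ad X \o (ad Y \o ad Z) - (ad Y \o ad X \o ad Z))%VF.
  by apply/lfunP => v; rewrite !(comp_lfunE, add_lfunE, opp_lfunE) ad_ad.
have -> : (ad X \o ad (ad Y Z))%VF =
    (ad X \o (ad Y \o ad Z) - (ad X \o ad Z \o ad Y))%VF.
  apply/lfunP => v.
  by rewrite !(comp_lfunE, add_lfunE, opp_lfunE) ad_ad linearB.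
rewrite !lfun_traceB; congr (_ - _).
by rewrite -comp_lfunA lfun_traceC.
Qed.

Lemma killingZ (X Y : g) c : killing X (c *: Y) = c * killing X Y.
Proof. by rewrite /killing -lfun_traceZ linearZ comp_lfunZr. Qed.

Lemma killing_linear (X : g) : linear_for *%R (killing X).
Proof.
move=> a Y Z; rewrite /killing -lfun_trace_linear.
by congr lfun_trace; rewrite linearP comp_lfunDr comp_lfunZr.
Qed.

End Trace.

(** * Weights of a Cartan subalgebra *)

Section Diagonalization.
Variables (K : fieldType) (g : lieAlgebra K).
Implicit Types f : 'End(g).
Import passmx.
Let e := vbasis {:g}.
Let eP : basis_of {:g} e := vbasisP {:g}.

Lemma diagonalizable_lfun_mx f :
  diagonalizable_lfun f -> diagonalizable (mxof e e f).
Proof.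
move=> [b bP bE]; have sb : size b == \dim {:g}.
  by rewrite (size_basis (X := in_tuple b) bP).
pose t := Tuple sb; have tP : basis_of {:g} t := bP.
have Pu : mxof t e \1 \in unitmx.
  suff: mxof t e \1 *m mxof e t \1 = 1%:M by case/mulmx1_unit.
  by rewrite -(mxof_comp _ _ eP) comp_lfun1l mxof1 ?(basis_free tP).
exists (mxof t e \1) => //; apply/diagonalizable_forPex.
exists (\row_i coord t i (f t`_i)); apply/(simmxP Pu).
have bE' (i : 'I_(\dim {:g})) : f t`_i = coord t i (f t`_i) *: t`_i.
  have [|c fc] := bE t`_i; first by rewrite mem_nth // size_tuple.
  rewrite fc; congr (_ *: _).
  by rewrite linearZ /= coord_free ?(basis_free tP) // eqxx; exact/esym/mulr1.
rewrite -(mxof_comp _ _ eP) comp_lfun1r; apply/row_matrixP => i.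
rewrite row_mul row_diag_mx -scalemxAl -rowE mxE !rowE. rewrite !mul_mxof.
by rewrite vecof_delta id_lfunE [in LHS]bE' linearZ.
Qed.

Lemma codiagonalizable_lfun (fs : seq 'End(g)) :
  {in fs, forall f, diagonalizable_lfun f} ->
  {in fs &, forall f f', (f \o f' = f' \o f)%VF} ->
  exists2 b : (\dim {:g}).-tuple g, basis_of {:g} b &
    {in fs, forall f (i : 'I_(\dim {:g})), f b`_i = coord b i (f b`_i) *: b`_i}.
Proof.
move=> fsD fsC.
have : codiagonalizable (map (mxof e e) fs).
  apply/codiagonalizableP; split.
    move=> X Y /mapP[f ff ->] /mapP[f' ff' ->].
    by rewrite /comm_mx -!(mxof_comp _ _ eP) fsC.
  by move=> _ /mapP[f ff ->]; apply/diagonalizable_lfun_mx/fsD.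
move=> [P Pu /allP /= Pfs].
(* The rows of [P] are the coordinates of joint eigenvectors, so [F] carries the basis [e] to a
   joint eigenbasis. *)
pose F := hommx e e P.
have Finj : lker F == 0%VS.
  apply/lker0P => u v; rewrite /F !(hommxE eP eP) => /(can_inj (vecofK eP)).
  have Pf : row_free P by rewrite row_free_unit.
  by move=> /(row_free_inj Pf) /(can_inj (rVofK eP)).
pose b := map_tuple F e.
have bP : basis_of {:g} b.
  have /limg_basis_of/(_ eP) : (fullv :&: lker F)%VS = 0%VS.
    by rewrite (eqP Finj) capv0.
  by rewrite (lker0_limgf Finj).
exists b => //.
move=> f ff i.
have bf := basis_free bP.
have bi : b`_i = vecof e (row i P).
  by rewrite (nth_map 0) ?size_tuple// /F (hommxE eP eP) rVofE// -rowE.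
have [D /(simmxP Pu) PD] := diagonalizable_forPex (Pfs _ (map_f _ ff)).
have fb : f b`_i = D 0 i *: b`_i.
  rewrite bi (hom_vecof e eP) -row_mul PD row_mul row_diag_mx -scalemxAl -rowE.
  by rewrite linearZ.
rewrite fb; congr (_ *: _).
by rewrite linearZ /= coord_free // eqxx; exact/esym/mulr1.
Qed.

End Diagonalization.

Section Weights.
Variables (K : numFieldType) (g : lieAlgebra K) (h : {vspace g}).
Hypothesis hh : cartan_subalgebra h.
Implicit Types (X Y Z v : g) (H : subvs_of h) (a b : dual_space h).

(** A basis of [h] yields finitely many commuting diagonalizable operators, hence a joint
    eigenbasis; the eigenvalues extend linearly to all of [h]. *)
Lemma weight_basis :
  exists (w : (\dim {:g}).-tuple g) (wt : 'I_(\dim {:g}) -> dual_space h),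
  basis_of {:g} w /\ forall i : 'I_(\dim {:g}), in_root_space (wt i) w`_i.
Proof.
have [hab _ hdiag] := hh.
have [||w wP wE] := @codiagonalizable_lfun _ _ [seq ad X | X <- vbasis h].
- by move=> _ /mapP[X /vbasis_mem Xh ->]; apply: hdiag.
- move=> _ _ /mapP[X /vbasis_mem Xh ->] /mapP[Y /vbasis_mem Yh ->].
  apply/lfunP => Z; rewrite !comp_lfunE; apply/eqP.
  by rewrite -subr_eq0 -ad_ad (hab X Y) // linear0 zero_lfunE.
have wtP (i : 'I_(\dim {:g})) : exists a : dual_space h,
    forall H, a H = coord w i (ad (vsval H) w`_i).
  exists (linfun (fun H => coord w i (ad (vsval H) w`_i) : K^o)) => H.
  rewrite linfunE // => c H1 H2.
  by rewrite !linearP /= add_lfunE scale_lfunE !linearP.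
have [wt wtE] := choice wtP.
exists w, wt; split => // i H; rewrite wtE.
rewrite (coord_vbasis (subvsP H)) linear_sum /= sum_lfunE linear_sum scaler_suml.
apply: eq_bigr => j _; rewrite linearZ /= scale_lfunE linearZ -scalerA /=.
by rewrite [in LHS](wE _ (map_f _ (mem_nth _ _))) ?size_tuple.
Qed.

Lemma in_root_spaceZ a c X : in_root_space a X -> in_root_space a (c *: X).
Proof. by move=> aX H; rewrite linearZ /= aX !scalerA mulrC. Qed.

Lemma in_root_space_ad a b X Y :
  in_root_space a X -> in_root_space b Y -> in_root_space (a + b) (ad X Y).
Proof.
move=> aX bY H.
have := ad_ad (vsval H) X Y; rewrite aX bY !linearZ /= scale_lfunE scalerN => E.
by rewrite -[LHS](subrK (b H *: ad X Y)) -E add_lfunE scalerDl.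
Qed.

Lemma in_root_space_inj a b X : X != 0 ->
  in_root_space a X -> in_root_space b X -> a = b.
Proof.
move=> X0 aX bX; apply/lfunP => H; apply/eqP; rewrite -subr_eq0.
have : (a H - b H) *: X == 0 by rewrite scalerBl -aX -bX subrr.
by rewrite scaler_eq0 (negPf X0) orbF.
Qed.

(** A vector of weight zero commutes with [h], so [h + <[X]>] is still abelian and maximality of [h]
    applies. *)
Lemma in_root_space0 X : in_root_space (0 : dual_space h) X <-> X \in h.
Proof.
have [hab hmax _] := hh; split=> [X0|Xh H]; last first.
  by rewrite hab ?subvsP // zero_lfunE scale0r.
have comm Y : Y \in h -> ad Y X = 0.
  by move=> Yh; have := X0 (vsproj h Y); rewrite vsprojK // zero_lfunE scale0r.
have <- : (h + <[X]>)%VS = h.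
  apply: hmax (addvSl _ _) => U V /memv_addP[u uh [_ /vlineP[c ->] ->]].
  move=> /memv_addP[v vh [_ /vlineP[c' ->] ->]].
  rewrite !linearD /= !add_lfunE (hab u v) // !linearZ /= !scale_lfunE.
  by rewrite comm // adC comm // ad_alternating oppr0 !scaler0 !addr0.
by rewrite memvE addvSr.
Qed.

Lemma ad_eq0_of_weights X : (forall a v, in_root_space a v -> ad X v = 0) -> ad X = 0.
Proof.
move=> X0; have [w [wt [wP wE]]] := weight_basis.
apply/(fullv_lfunP (ad X) 0 (span_basis wP)).
by move=> v /tnthP[i ->]; rewrite zero_lfunE (tnth_nth 0) (X0 _ _ (wE i)).
Qed.


Lemma in_root_space_coord a v : in_root_space a v ->
  forall (w : (\dim {:g}).-tuple g) (wt : 'I_(\dim {:g}) -> dual_space h),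
  basis_of {:g} w -> (forall i : 'I_(\dim {:g}), in_root_space (wt i) w`_i) ->
  forall i, coord w i v != 0 -> wt i = a.
Proof.
move=> av w wt wP wE i vi; apply/lfunP => H; apply: (mulIf vi).
have := av H; rewrite [v in LHS](coord_basis wP) ?memvf // linear_sum.
move=> /(congr1 (coord w i)); rewrite linearZ /= => <-.
under eq_bigr do rewrite linearZ /= wE scalerA.
by rewrite coord_sum_free ?(basis_free wP) // mulrC.
Qed.

Lemma finite_weights : exists s : seq (dual_space h),
  forall a v, v != 0 -> in_root_space a v -> a \in s.
Proof.
have [w [wt [wP wE]]] := weight_basis; exists (codom wt) => a v v0 av.
apply: contraNT v0 => /negP as_; rewrite (coord_basis wP (memvf v)).
rewrite big1 // => i _; have [->|vi] := eqVneq (coord w i v) 0.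
  by rewrite scale0r.
by case: as_; rewrite -(in_root_space_coord av wP wE vi) codom_f.
Qed.

Lemma in_root_space_iter a b X v n : in_root_space a X -> in_root_space b v ->
  in_root_space (b + a *+ n) (iter n (ad X) v).
Proof.
move=> aX bv; elim: n => [|n IH]; first by rewrite mulr0n addr0.
by rewrite iterS mulrS addrCA; apply: in_root_space_ad.
Qed.

(** In characteristic zero the weights [b + a *+ n] are pairwise distinct, whereas only finitely
    many weights exist. *)
Lemma ad_nilpotent a b X v : a != 0 -> in_root_space a X -> in_root_space b v ->
  exists n, iter n (ad X) v == 0.
Proof.
move=> a0 aX bv; have [s sP] := finite_weights.
apply: contrapT => /forallNP it0.
pose f (n : nat) := b + a *+ n.
have : (size (map f (iota 0 (size s).+1)) <= size s)%N.
  apply: uniq_leq_size => [|_ /mapP[n _ ->]].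
    rewrite map_inj_uniq ?iota_uniq // => i j /addrI /eqP.
    rewrite -[a *+ i]scaler_nat -[a *+ j]scaler_nat.
    by rewrite -subr_eq0 -scalerBl scaler_eq0 (negPf a0) orbF subr_eq0 eqr_nat => /eqP.
  by apply: sP (in_root_space_iter n aX bv); apply/negP/it0.
by rewrite size_map size_iota ltnn.
Qed.

Lemma highest_vector a b X v :
  a != 0 -> in_root_space a X -> v != 0 -> in_root_space b v ->
  exists p, iter p (ad X) v != 0 /\ ad X (iter p (ad X) v) = 0.
Proof.
move=> a0 aX v0 bv; have ex := ad_nilpotent a0 aX bv.
case: (ex_minnP ex) => -[|p] itp pmin; first by rewrite itp in v0.
exists p; split; last exact/eqP.
by apply/negP => /pmin; rewrite ltnn.
Qed.

(** * Root strings *)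

Section String.
Variables (a : dual_space h) (X Y : g).
Hypotheses (aX : in_root_space a X) (aY : in_root_space (- a) Y).
Variable (T : subvs_of h).
Hypothesis TE : ad X Y = vsval T.

(** The sl2 commutation rule with [T] left unnormalized: the contributions (b - ka)(T) for k = 0,
    ..., n add up, and 0 + ... + n is the binomial coefficient. *)
Lemma string_raise b v n : in_root_space b v -> ad X v = 0 ->
  ad X (iter n.+1 (ad Y) v) =
  (b T *+ n.+1 - a T *+ 'C(n.+1, 2)) *: iter n (ad Y) v.
Proof.
move=> bv Xv; elim: n => [|n IH].
  rewrite /= -[LHS](subrK (ad Y (ad X v))) -ad_ad Xv linear0 addr0 TE bv.
  by rewrite mulr1n bin_small // mulr0n subr0.
rewrite iterS -[LHS](subrK (ad Y (ad X (iter n.+1 (ad Y) v)))) -ad_ad TE IH.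
rewrite (in_root_space_iter n.+1 aY bv); set c := (b T *+ n.+1 - a T *+ 'C(n.+1, 2)).
rewrite linearZ /= -iterS -scalerDl /c.
congr (_ *: _); rewrite add_lfunE mulNrn opp_lfunE (binS n.+1) bin1.
have -> : (a *+ n.+1) T = a T *+ n.+1.
  by rewrite -[a *+ n.+1]scaler_nat scale_lfunE; exact: mulr_natl.
move: 'C(n.+1, 2) => C.
rewrite [b T *+ n.+2]mulrS mulrnDr opprD addrACA; congr (_ + _); exact: addrC.
Qed.

Hypothesis a0 : a != 0.

(** Climb [p] steps to a highest vector [u], then descend until the last nonzero iterate, number
    [m]. The raising coefficient of the next iterate must vanish; doubling it and dividing by m + 1
    gives the equation. The case a(T) = 0 is not excluded. *)
Lemma root_string b v : v != 0 -> in_root_space b v ->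
  exists p m, b T *+ 2 + a T *+ p.*2 = a T *+ m /\
    forall k, (k <= m)%N ->
      exists2 u, u != 0 & in_root_space (b + a *+ p - a *+ k) u.
Proof.
move=> v0 bv; have [p [u0 Xu]] := highest_vector a0 aX v0 bv.
have bu := in_root_space_iter p aX bv.
move: (iter p _ v) u0 Xu bu => u u0 Xu bu; exists p.
have Na0 : - a != 0 by rewrite oppr_eq0.
have ex := ad_nilpotent Na0 aY bu.
case: (ex_minnP ex) => -[|m] itm mmin; first by rewrite itm in u0.
exists m; split=> [|k km]; last first.
  exists (iter k (ad Y) u); last by rewrite -mulNrn; apply: in_root_space_iter.
  by apply/negP => /mmin; rewrite ltnNge km.
have um0 : iter m (ad Y) u != 0 by apply/negP => /mmin; rewrite ltnn.
have := string_raise m bu Xu; rewrite (eqP itm) linear0 => /esym/eqP.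
rewrite scaler_eq0 (negPf um0) orbF subr_eq0 => /eqP E.
have aMn : (a *+ p) T = a T *+ p.
  by rewrite -[a *+ p]scaler_nat scale_lfunE; exact: mulr_natl.
have m0 : m.+1%:R != 0 :> K by rewrite pnatr_eq0.
have CE : ('C(m.+1, 2) * 2 = m * m.+1)%N.
  by rewrite mulnC -(mul_bin_diag m.+1 1) bin1 mulnC.
apply: (mulIf m0); rewrite !mulr_natr -[RHS]mulrnA -CE [RHS]mulrnA -E.
rewrite add_lfunE aMn -mul2n mulnC [_ *+ (p * 2)]mulrnA -mulrnDl.
by rewrite -!mulrnA mulnC.
Qed.

End String.

End Weights.

(** * Nondegeneracy of the Killing form *)

Section Simple.
Variables (K : numFieldType) (g : lieAlgebra K).
Hypothesis hg : lie_simple g.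
Implicit Types (X Y Z v : g).

(** The centre is an ideal, and it is not everything because [g] is not abelian. *)
Lemma simple_ad_inj X : ad X = 0 -> X = 0.
Proof.
move=> X0; have [nab hI] := hg.
have [|k0|kf] := hI (lker ad).
- move=> U V; rewrite !memv_ker => /eqP V0; apply/eqP/lfunP => W.
  by rewrite ad_ad V0 zero_lfunE linear0 zero_lfunE subr0.
- by apply/eqP; rewrite -memv0 -k0 memv_ker X0.
- case: nab => U V; have : U \in lker ad by rewrite kf memvf.
  by rewrite memv_ker => /eqP ->; rewrite zero_lfunE.
Qed.

Variables (h : {vspace g}).
Hypothesis hh : cartan_subalgebra h.
Implicit Types (H : subvs_of h) (a b : dual_space h).

Lemma killing_weights (w : (\dim {:g}).-tuple g) (wt : 'I_(\dim {:g}) -> dual_space h) :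
  basis_of {:g} w -> (forall i : 'I_(\dim {:g}), in_root_space (wt i) w`_i) ->
  forall H H', killing (vsval H) (vsval H') = \sum_i wt i H * wt i H'.
Proof.
move=> wP wE H H'; rewrite /killing (lfun_trace_basis _ wP).
apply: eq_bigr => i _; rewrite comp_lfunE wE linearZ /= wE scalerA linearZ /=.
by rewrite coord_free ?(basis_free wP) // eqxx [RHS]mulrC; exact: mulr1.
Qed.

(* Along a root string the weights evaluate at [X, Y] to rational multiples
   of a([X, Y]), so that the Killing form at ([X, Y], [X, Y]) is a sum of
   rational squares times a([X, Y])^2. *)
Lemma ad_opposite_eq0 a X Y : a != 0 -> in_root_space a X -> in_root_space (- a) Y ->
  (forall H, killing (vsval H) (vsval H) = 0) -> ad X Y = 0.
Proof.
move=> a0 aX aY kill0; apply: simple_ad_inj.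
have XYh : ad X Y \in h.
  by apply/(in_root_space0 hh); rewrite -(subrr a); apply: in_root_space_ad.
pose T := vsproj h (ad X Y).
have TE : ad X Y = vsval T by rewrite vsprojK.
have [w [wt [wP wE]]] := weight_basis hh.
have w0 (i : 'I_(\dim {:g})) : w`_i != 0.
  by apply: free_not0 (basis_free wP) _; rewrite mem_nth ?size_tuple.
have qP i : exists q, q \is Num.real /\ wt i T = q * a T.
  have [p [m [E _]]] := root_string hh aX aY TE a0 (w0 i) (wE i).
  exists ((m%:R - p.*2%:R) / 2); split.
    by rewrite rpred_div ?rpredB ?rpred_nat.
  have n2 : 2 != 0 :> K by rewrite pnatr_eq0.
  apply: (mulIf n2); rewrite [RHS]mulrAC divfK // mulr_natr.
  rewrite -[LHS](addrK (a T *+ p.*2)) E.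
  by rewrite -[a T *+ m]mulr_natl -[a T *+ p.*2]mulr_natl mulrBl.
have [q qE] := choice qP.
have wt0 i : wt i T = 0.
  have [aT0|aT0] := eqVneq (a T) 0; first by rewrite (qE i).2 aT0 mulr0.
  have := kill0 T; rewrite (killing_weights wP wE).
  under eq_bigr do rewrite (qE _).2 mulrACA -expr2.
  rewrite -mulr_suml => /eqP; rewrite mulf_eq0 mulf_eq0 (negPf aT0) !orbF.
  rewrite psumr_eq0 => [/allP /(_ i (mem_index_enum _)) /=|j _]; last first.
    by rewrite real_exprn_even_ge0 ?(qE j).1.
  by rewrite sqrf_eq0 (qE i).2 => /eqP ->; rewrite mul0r.
apply/(fullv_lfunP _ 0 (span_basis wP)) => v /tnthP[i ->].
by rewrite zero_lfunE TE (tnth_nth 0) wE wt0 scale0r.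
Qed.

(** Otherwise opposite weight spaces commute, so the sum [J] of the nonzero weight spaces is an
    ideal. If [J] is zero, [g] equals [h] and is abelian. If [J] is everything, [h] is zero, hence
    so are all weights, and again [g] equals [h]. *)
Lemma killing_cartan_neq0 : ~ (forall H, killing (vsval H) (vsval H) = 0).
Proof.
move=> kill0; have [nab hI] := hg; have [hab hmax _] := hh.
have [w [wt [wP wE]]] := weight_basis hh.
have w0 (i : 'I_(\dim {:g})) : w`_i != 0.
  by apply: free_not0 (basis_free wP) _; rewrite mem_nth ?size_tuple.
pose J : {vspace g} := (\sum_(i | wt i != 0%R) <[w`_i]>)%VS.
have mem_J a v : a != 0 -> in_root_space a v -> v \in J.
  move=> a0 av; rewrite (coord_basis wP (memvf v)) memv_suml // => i _.
  have [->|vi] := eqVneq (coord w i v) 0; first by rewrite scale0r mem0v.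
  apply: memvZ; rewrite memvE; apply: (sumv_sup i); last exact: subvv.
  by rewrite (in_root_space_coord av wP wE vi).
have J_ideal : lie_ideal J.
  move=> X Y /memv_sumP[y yJ ->]; rewrite linear_sum memv_suml // => j j0.
  have /vlineP[c ->] := yJ j j0; rewrite linearZ memvZ //=.
  rewrite (coord_basis wP (memvf X)) linear_sum sum_lfunE memv_suml // => i _.
  rewrite linearZ /= scale_lfunE memvZ //=.
  have [ij|ij] := eqVneq (wt i + wt j) 0; last first.
    by apply: mem_J ij _; apply: in_root_space_ad.
  rewrite (@ad_opposite_eq0 (- wt j)) ?mem0v ?oppr_eq0 ?opprK //.
  by have /eqP := ij; rewrite addr_eq0 => /eqP <-.
have wt_h i : wt i = 0 -> w`_i \in h.
  by move=> i0; apply/(in_root_space0 hh); rewrite -i0.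
have not_all0 : ~ forall i, wt i = 0.
  move=> all0; have gh X : X \in h.
    by rewrite (coord_basis wP (memvf X)) memv_suml // => i _; rewrite memvZ // wt_h.
  by case: nab => X Y; rewrite hab.
have [J0|Jf] := hI J J_ideal.
  apply: not_all0 => i; apply/eqP; apply: contraNT (w0 i) => i0.
  by rewrite -memv0 -J0; apply: mem_J (wE i).
apply: not_all0 => i; apply/lfunP => H; rewrite zero_lfunE.
suff -> : H = 0 by rewrite linear0.
apply/val_inj => /=; have : vsval H \in J by rewrite Jf memvf.
move=> /memv_sumP[y yJ Hy].
have H0 := (in_root_space0 hh _).2 (subvsP H).
rewrite (coord_basis wP (memvf (vsval H))) big1 // => j _.
have [->|Hj] := eqVneq (coord w j (vsval H)) 0; first by rewrite scale0r.
case/eqP: (Hj); rewrite Hy linear_sum big1 // => k k0 /=.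
have /vlineP[c ->] := yJ k k0; rewrite linearZ /= coord_free ?(basis_free wP) //.
case: eqVneq => [jk|_]; last exact: mulr0.
by move: k0; rewrite jk (in_root_space_coord H0 wP wE Hj) eqxx.
Qed.

(** By invariance the radical is an ideal; it is not all of [g], since the form does not vanish
    identically on the diagonal of [h]. *)
Lemma killing_nondegenerate X : (forall Y, killing X Y = 0) -> X = 0.
Proof.
move=> X0; have [nab hI] := hg.
pose kap : 'Hom(g, 'Hom(g, K^o)) := linfun (fun X => linfun (killing X : g -> K^o)).
have kapE U V : kap U V = killing U V.
  have kl W : linear (killing W : g -> K^o) by exact: killing_linear.
  rewrite linfunE ?linfunE // => c A B; apply/lfunP => C.
  rewrite add_lfunE scale_lfunE !linfunE // killingC.
  by rewrite killing_linear ![killing C _]killingC.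
have kerE U : (U \in lker kap) <-> forall V, killing U V = 0.
  rewrite memv_ker; split=> [/eqP U0 V|U0]; first by rewrite -kapE U0 zero_lfunE.
  by apply/eqP/lfunP => V; rewrite kapE U0 zero_lfunE.
have [|k0|kf] := hI (lker kap).
- move=> U V /kerE V0; apply/kerE => W.
  by rewrite killing_ad killingC killing_ad V0.
- by apply/eqP; rewrite -memv0 -k0; apply/kerE.
- case: killing_cartan_neq0 => H; move: (memvf (vsval H)); rewrite -kf => /kerE; exact.
Qed.
End Simple.

(** * The root system *)

Section RootSystem.
Variables (K : numFieldType) (g : lieAlgebra K) (h : {vspace g}).
Hypotheses (hg : lie_simple g) (hh : cartan_subalgebra h).
Implicit Types (X Y Z v : g) (H : subvs_of h) (a b : dual_space h).

Lemma killing_root_space a b X Y : in_root_space a X -> in_root_space b Y ->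
  a + b != 0 -> killing X Y = 0.
Proof.
move=> aX bY /lfunPn[H]; rewrite zero_lfunE add_lfunE => abH.
apply: (mulfI abH); rewrite mulr0 mulrDl -[b H * _]killingZ -bY -killing_ad adC aX.
by rewrite -scaleNr [killing (_ *: _) _]killingC killingZ killingC mulNr subrr.
Qed.

(** Nondegeneracy gives a weight basis vector not orthogonal to [X], and orthogonality of weight
    spaces forces its weight to be -a. The case a = 0 is included and yields nondegeneracy on
    [h]. *)
Lemma killing_pairing a X : X != 0 -> in_root_space a X ->
  exists2 Y, in_root_space (- a) Y & killing X Y = 1.
Proof.
move=> X0 aX; have [w [wt [wP wE]]] := weight_basis hh.
have [i Xi] : exists i : 'I_(\dim {:g}), killing X w`_i != 0.
  apply: contrapT => /forallNP all0; case/eqP: X0.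
  apply: (killing_nondegenerate hg hh) => Y.
  have kE : linfun (killing X : g -> K^o) =1 killing X.
    by apply: linfunE; exact: killing_linear.
  suff k0 : linfun (killing X : g -> K^o) = 0 by rewrite -kE k0 zero_lfunE.
  apply/(fullv_lfunP _ 0 (span_basis wP)) => v /tnthP[i ->].
  by rewrite zero_lfunE kE (tnth_nth 0); apply/eqP/negPn/negP/all0.
exists ((killing X w`_i)^-1 *: w`_i); last by rewrite killingZ mulVf.
apply: in_root_spaceZ; suff -> : - a = wt i by [].
apply/eqP; rewrite eq_sym -addr_eq0 addrC.
by apply: contraNT Xi => /(killing_root_space aX (wE i)) ->.
Qed.

Lemma killing_dualE H H' : killing_dual h H H' = killing (vsval H) (vsval H').
Proof.
have lin (A : subvs_of h) :
    linear (fun B : subvs_of h => killing (vsval A) (vsval B) : K^o).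
  by move=> c B B'; rewrite linearP; exact: killing_linear.
rewrite linfunE ?linfunE // => c A B; apply/lfunP => D.
rewrite add_lfunE scale_lfunE !linfunE // linearP killingC.
by rewrite killing_linear ![killing (vsval D) _]killingC.
Qed.

Lemma killing_dual_inj : lker (killing_dual h) == 0%VS.
Proof.
rewrite -subv0; apply/subvP => H; rewrite memv_ker memv0 => /eqP H0.
apply: contraT => Hn0; have := (in_root_space0 hh (vsval H)).2 (subvsP H).
case/killing_pairing => // Y; rewrite oppr0 => /(in_root_space0 hh) Yh.
rewrite -(vsprojK Yh) -killing_dualE H0 zero_lfunE => /eqP.
by rewrite eq_sym oner_eq0.
Qed.

Lemma killing_dualK : cancel (killing_dual h)^-1%VF (killing_dual h).
Proof.
move=> a; apply: limg_lfunVK; suff -> : limg (killing_dual h) = fullv by apply: memvf.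
apply/eqP; rewrite eqEdim subvf limg_dim_eq ?(eqP killing_dual_inj) ?capv0 //=.
by rewrite !dimvf [X in (X <= _)%N]muln1.
Qed.

Local Notation t := ((killing_dual h)^-1%VF).

(** Nondegeneracy on [h] allows testing against each [H]; there invariance turns the left side into
    a(H) times [killing X Y]. *)
Lemma ad_opposite a X Y : in_root_space a X -> in_root_space (- a) Y ->
  ad X Y = killing X Y *: vsval (t a).
Proof.
move=> aX aY; have XYh : ad X Y \in h.
  by apply/(in_root_space0 hh); rewrite -(subrr a); apply: in_root_space_ad.
rewrite -(vsprojK XYh) -linearZ; congr vsval.
have /lker0P inj := killing_dual_inj; apply: inj; apply/lfunP => H.
rewrite linearZ /= scale_lfunE killing_dualK killing_dualE vsprojK //.
by rewrite killing_ad adC aY opp_lfunE scaleNr opprK killingZ mulrC.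
Qed.

Lemma root_sl2 a : is_root a -> exists X Y,
  [/\ X != 0, in_root_space a X, in_root_space (- a) Y & ad X Y = vsval (t a)].
Proof.
move=> [_ [X X0 aX]]; have [Y aY XY] := killing_pairing X0 aX.
by exists X, Y; rewrite (ad_opposite aX aY) XY scale1r.
Qed.

(** If a(t_a) were 0, the string equation would make every weight vanish at t_a. Then t_a is
    central, hence zero, and so is [a]. *)
Lemma dual_form_root_neq0 a : is_root a -> dual_form a a != 0.
Proof.
move=> ra; have [X [Y [X0 aX aY XY]]] := root_sl2 ra; have [a0 _] := ra.
apply/eqP => N0; case/eqP: (a0); rewrite -[a]killing_dualK.
suff -> : t a = 0 by rewrite linear0.
apply/val_inj; rewrite /= -XY; apply: (simple_ad_inj hg).
apply: (ad_eq0_of_weights hh) => b v bv.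
have [->|v0] := eqVneq v 0; first exact: linear0.
have [p [m [+ _]]] := root_string hh aX aY XY a0 v0 bv.
rewrite [a (t a)]N0 !mul0rn addr0 => /eqP; rewrite mulrn_eq0 /= => /eqP bT.
by rewrite XY bv bT scale0r.
Qed.

Lemma reflectionE a b :
  reflection a b = b - (2%:R * dual_form b a / dual_form a a) *: a.
Proof.
rewrite linfunE // => c u v; rewrite scalerBr addrACA -opprD scalerA -scalerDl.
congr (_ - _ *: _); rewrite /dual_form add_lfunE scale_lfunE.
by rewrite [c *: _]/(c * _) mulrDr mulrDl mulrCA !mulrA.
Qed.

Lemma dual_formB a b c x : dual_form (b - x *: c) a = dual_form b a - x * dual_form c a.
Proof. by rewrite /dual_form add_lfunE opp_lfunE scale_lfunE. Qed.

Lemma reflectionK a : is_root a -> involutive (reflection a).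
Proof.
move=> /dual_form_root_neq0 N0 b; rewrite !reflectionE dual_formB.
rewrite -addrA -opprD -scalerDl divfK // mulrBr mulrBl.
set x := 2%:R * _ / _.
have -> : x + (x - 2%:R * (2%:R * dual_form b a) / dual_form a a) = 0.
  by rewrite /x -!mulrA; ring.
by rewrite scale0r subr0.
Qed.

(** The string equation identifies 2(b,a)/(a,a) with m - 2p, so the reflected weight lies m - p
    steps below the top of the string. This position is on the string when p <= m; otherwise the
    string in direction -a is used. *)
Lemma reflection_root a b : is_root a -> is_root b -> is_root (reflection a b).
Proof.
move=> ra [b0 [v v0 bv]]; split.
  by rewrite -(inj_eq (can_inj (reflectionK ra))) reflectionK // linear0.
have [X [Y [X0 aX aY XY]]] := root_sl2 ra; have [a0 _] := ra.
have N0 := dual_form_root_neq0 ra.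
have [p [m [E mP]]] := root_string hh aX aY XY a0 v0 bv.
have YX : ad Y X = vsval (- t a) by rewrite adC XY linearN.
have aX' : in_root_space (- - a) X by rewrite opprK.
have Na0 : - a != 0 by rewrite oppr_eq0.
have [p' [m' [E' mP']]] := root_string hh aY aX' YX Na0 v0 bv.
rewrite opp_lfunE !linearN opprK /= in E'.
have {}E : dual_form b a *+ 2 + dual_form a a *+ p.*2 = dual_form a a *+ m := E.
have {}E' : - dual_form b a *+ 2 + dual_form a a *+ p'.*2 = dual_form a a *+ m' := E'.
(* The two string equations give opposite values of 2(b,a)/(a,a); their sum shows that p > m forces
   p' <= m'. *)
have pm : (m + m' = p.*2 + p'.*2)%N.
  apply/eqP; rewrite -(eqr_nat K); apply/eqP/(mulfI N0).
  rewrite !mulr_natr !mulrnDr -E -E' mulNrn addrACA subrr add0r.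
  by [].
rewrite reflectionE.
have [lepm|ltmp] := leqP p m.
  have -> : 2%:R * dual_form b a / dual_form a a = m%:R - p.*2%:R.
    apply: (mulIf N0); rewrite divfK // mulrBl !mulr_natl -E addrK //.
  have [u u0 uP] := mP _ (leq_subr p m); exists u => //.
  suff <- : b + a *+ p - a *+ (m - p) = b - (m%:R - p.*2%:R) *: a by [].
  rewrite scalerBl !scaler_nat mulrnBr // -addnn mulrnDr.
  by rewrite -addrA; congr (_ + _); rewrite !opprB addrA.
have lepm' : (p' <= m')%N by lia.
have -> : 2%:R * dual_form b a / dual_form a a = p'.*2%:R - m'%:R.
  apply: (mulIf N0); rewrite divfK // mulrBl !mulr_natl -E' opprD addrCA subrr.
  by rewrite addr0 mulNrn opprK.
have [u u0 uP] := mP' _ (leq_subr p' m'); exists u => //.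
suff <- : b + - a *+ p' - - a *+ (m' - p') = b - (p'.*2%:R - m'%:R) *: a by [].
rewrite scalerBl !scaler_nat !mulNrn mulrnBr // -addnn mulrnDr.
by rewrite opprK -addrA; congr (_ + _); rewrite opprB opprD addrCA.
Qed.

(* For n > 1 take a highest vector Z in the a-string above g_(a *+ n), of
   weight a *+ k.+2 say.  Lowering it to weights 0 and a gives a multiple of
   t a and hence, raising again, a nonzero multiple of X in g_a, on which
   [ad X] vanishes although the raising coefficient there is nonzero. *)
Lemma root_mulrn a n : is_root a -> is_root (a *+ n) -> n = 1%N.
Proof.
move=> ra [an0 [v v0 av]]; have [a0 _] := ra.
have [X [Y [X0 aX aY XY]]] := root_sl2 ra.
have N0 := dual_form_root_neq0 ra.
have [p [Z0 XZ]] := highest_vector hh a0 aX v0 av.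
have := in_root_space_iter p aX av; rewrite -mulrnDr.
case: n an0 {av} Z0 XZ => [|[|n]] //; first by rewrite mulr0n eqxx.
move=> _; move: (iter p _ v) => Z Z0 XZ; rewrite !addSn; move: (n + p)%N => k aZ.
(* The raising coefficient is (a,a) times (k+2)(j+1) - j(j+1)/2, a positive integer because j <
   2(k+2). *)
have up j : (j <= k.+1)%N -> exists2 c, c != 0 &
    ad X (iter j.+1 (ad Y) Z) = c *: iter j (ad Y) Z.
  move=> jk; exists (dual_form a a *+ (k.+2 * j.+1 - 'C(j.+1, 2))); last first.
    rewrite (string_raise aY XY j aZ XZ); congr (_ *: _).
    have -> : (a *+ k.+2) (t a) = dual_form a a *+ k.+2.
      by rewrite -[a *+ _]scaler_nat scale_lfunE; exact: mulr_natl.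
    rewrite -mulrnA mulrnBr //.
    by have := mul_bin_diag j.+1 1; rewrite /= bin1; nia.
  rewrite mulrn_eq0 negb_or N0 andbT subn_eq0 -ltnNge.
  by have := mul_bin_diag j.+1 1; rewrite /= bin1; nia.
have down j : (j <= k.+2)%N -> iter j (ad Y) Z != 0.
  elim: j => // j IH jk; have [c c0 E] := up j jk.
  apply/eqP => Yj0; move: E; rewrite Yj0 linear0 => /esym/eqP.
  by rewrite scaler_eq0 (negPf c0) (negPf (IH (ltnW jk))).
have aU : in_root_space a (iter k.+1 (ad Y) Z).
  suff <- : a *+ k.+2 + (- a) *+ k.+1 = a by apply: in_root_space_iter.
  by rewrite mulrS mulNrn addrK.
have [c c0] := up k.+1 (leqnn _); rewrite [iter k.+2 _ _]iterS.
have [c' c'0] := up k (leqnSn _); move: (iter k.+1 _ _) aU => u aU.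
move=> Xu; rewrite [ad Y u]adC (ad_opposite aU aY).
rewrite linearN linearZ /= [ad X _]adC aX => cE; move: Xu.
have -> : u = (c^-1 * killing u Y * a (t a)) *: X.
  rewrite -[LHS]scale1r -(mulVf c0) -[LHS]scalerA -cE.
  by rewrite -scalerN opprK !scalerA.
rewrite linearZ /= ad_alternating scaler0 => /esym/eqP.
by rewrite scaler_eq0 (negPf c'0) (negPf (down k _)) // ltnW.
Qed.

End RootSystem.

(** * Simple roots and bipartite Coxeter elements *)

Lemma free_sum_eq0 (K : fieldType) (V : vectType K) (S : seq V) (k : V -> K) :
  free S -> \sum_(c <- S) k c *: c = 0 -> {in S, forall c, k c = 0}.
Proof.
move=> fS; rewrite (big_nth 0) big_mkord => sum0 c cS.
have /freeP/(_ (fun i => k S`_i) sum0) : free (in_tuple S) by [].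
move: cS; rewrite -index_mem => lt_c /(_ (Ordinal lt_c)) /=.
by rewrite nth_index // -index_mem.
Qed.

Section SimpleRoots.
Variables (K : numFieldType) (g : lieAlgebra K) (h : {vspace g}).
Hypotheses (hg : lie_simple g) (hh : cartan_subalgebra h).
Implicit Types (a b c : dual_space h) (S Q : seq (dual_space h)).

Lemma reflection_id a : is_root a -> reflection a a = - a.
Proof.
move=> ra; rewrite reflectionE mulfK ?(dual_form_root_neq0 hg hh) //.
by rewrite scaler_nat mulr2n opprD addrA subrr sub0r.
Qed.

Lemma root_opp a : is_root a -> is_root (- a).
Proof. by move=> ra; rewrite -reflection_id //; apply: reflection_root. Qed.

Lemma nonneg_comb_perm S Q b : perm_eq S Q -> nonneg_comb S b -> nonneg_comb Q b.
Proof. by move=> SQ [n ->]; exists n; apply: perm_big. Qed.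

Lemma simple_roots_perm S Q : perm_eq S Q -> simple_roots S -> simple_roots Q.
Proof.
move=> SQ [fS rS cS]; split; first by rewrite -(perm_free SQ).
  by move=> a; rewrite -(perm_mem SQ); apply: rS.
by move=> b /cS[] nb; [left|right]; apply: nonneg_comb_perm nb.
Qed.

Lemma positive_roots_perm S Q : perm_eq S Q -> positive_roots S = positive_roots Q.
Proof.
move=> SQ; have QS : perm_eq Q S by rewrite perm_sym.
by apply/seteqP; split=> b [rb nb]; split=> //; apply: nonneg_comb_perm nb.
Qed.

(** * Positive roots and simple reflections *)

Section Positive.
Variable S : seq (dual_space h).
Hypothesis hS : simple_roots S.
Local Notation pos := (positive_roots S).

Lemma simple_positive a : a \in S -> pos a.
Proof.
have [fS rS _] := hS => aS; split; first exact: rS.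
exists (fun c => c == a : nat); rewrite (bigD1_seq a) ?free_uniq //= eqxx mulr1n.
by rewrite big1 ?addr0 // => c /negPf ->.
Qed.

Lemma root_positive_or a : is_root a -> pos a \/ pos (- a).
Proof.
have [_ _ cS] := hS => ra; case: (cS a ra) => na; [left|right]; split=> //.
exact: root_opp.
Qed.

Lemma positive_opp a : pos a -> ~ pos (- a).
Proof.
have [fS rS _] := hS => -[[a0 _] [n aE]] [_ [m NaE]]; case/eqP: a0.
have : \sum_(c <- S) (n c + m c)%:R *: c = 0.
  under eq_bigr do rewrite natrD scalerDl !scaler_nat.
  by rewrite big_split /= -aE -NaE subrr.
move=> /(free_sum_eq0 fS) nm0; rewrite aE big_seq big1 // => c /nm0 /eqP.
by rewrite pnatr_eq0 addn_eq0 => /andP[/eqP -> _].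
Qed.

(** The reflection changes only the coefficient at [a]. If the image were negative, all other
    coefficients of [b] would vanish, and a root that is a natural multiple of [a] equals [a]. *)
Lemma reflection_positive a b : a \in S -> pos b -> b != a -> pos (reflection a b).
Proof.
have [fS rS _] := hS => aS [rb [n bE]] ba; have ra := rS _ aS.
have [//|[_ [m mE]]] := root_positive_or (reflection_root hg hh ra rb).
case/eqP: ba; set z := 2%:R * dual_form b a / dual_form a a.
have : \sum_(c <- S) ((n c + m c)%:R - (if c == a then z else 0)) *: c = 0.
  under eq_bigr do rewrite natrD scalerBl scalerDl !scaler_nat.
  rewrite sumrB big_split /= -bE -mE reflectionE -/z opprB [b + _]addrC subrK.
  rewrite (bigD1_seq a) ?free_uniq //= eqxx big1 ?addr0 ?subrr //.
  by move=> c /negPf ->; rewrite scale0r.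
move=> /(free_sum_eq0 fS) nm0.
have {}bE : b = a *+ n a.
  rewrite bE (bigD1_seq a) ?free_uniq //= [X in _ + X]big_seq_cond.
  rewrite [X in _ + X]big1 ?addr0 // => c /andP[/nm0 + /negPf ca].
  by rewrite ca subr0 => /eqP; rewrite pnatr_eq0 addn_eq0 => /andP[/eqP -> _].
have n1 : n a = 1%N by apply: (root_mulrn hg hh ra); rewrite -bE.
by rewrite bE n1.
Qed.

End Positive.

Lemma reflections_prod_cons a Q b :
  reflections_prod (a :: Q) b = reflection a (reflections_prod Q b).
Proof. by rewrite /reflections_prod big_cons comp_lfunE. Qed.

Lemma reflections_prod_nil b : reflections_prod [::] b = b.
Proof. by rewrite /reflections_prod big_nil id_lfunE. Qed.

Lemma reflection_orthogonal a b : dual_form b a = 0 -> reflection a b = b.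
Proof. by move=> ab; rewrite reflectionE ab mulr0 mul0r scale0r subr0. Qed.

Lemma reflections_prod_orthogonal Q b :
  {in Q, forall a, dual_form b a = 0} -> reflections_prod Q b = b.
Proof.
elim: Q => [|a Q IH] bQ; first exact: reflections_prod_nil.
rewrite reflections_prod_cons IH => [|c cQ]; last by apply: bQ; rewrite inE cQ orbT.
by rewrite reflection_orthogonal // bQ // mem_head.
Qed.

Lemma dual_form_reflections_prod Q a b :
  {in Q, forall c, dual_form c a = 0} ->
  dual_form (reflections_prod Q b) a = dual_form b a.
Proof.
elim: Q => [|c Q IH] Qa; first by rewrite reflections_prod_nil.
rewrite reflections_prod_cons reflectionE dual_formB (Qa c) ?mem_head // mulr0 subr0.
by apply: IH => d dQ; apply: Qa; rewrite inE dQ orbT.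
Qed.

(** * Products of reflections in orthogonal simple roots *)

Section Orthogonal.
Variable S : seq (dual_space h).
Hypothesis hS : simple_roots S.

Lemma mutually_orthogonal_cons a Q : uniq (a :: Q) -> mutually_orthogonal (a :: Q) ->
  [/\ mutually_orthogonal Q, {in Q, forall c, dual_form a c = 0} &
      {in Q, forall c, dual_form c a = 0}].
Proof.
move=> /= /andP[aQ uQ] oQ.
split=> [b c bQ cQ|c cQ|c cQ]; first by apply: oQ; rewrite inE ?bQ ?cQ orbT.
  by apply: oQ; rewrite ?inE ?eqxx ?cQ ?orbT //; apply: contraNneq aQ => ->.
by apply: oQ; rewrite ?inE ?eqxx ?cQ ?orbT //; apply: contraNneq aQ => <-.
Qed.

Lemma reflections_prodK Q : uniq Q -> {subset Q <= S} -> mutually_orthogonal Q ->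
  involutive (reflections_prod Q).
Proof.
have [_ rS _] := hS; elim: Q => [|a Q IH] uQ QS oQ b.
  by rewrite !reflections_prod_nil.
have [oQ' aQ Qa] := mutually_orthogonal_cons uQ oQ.
have ra : is_root a by apply/rS/QS/mem_head.
rewrite !reflections_prod_cons.
(* The product over [Q] fixes [a] and preserves pairings with [a], so it commutes with the
   reflection in [a]. *)
have -> c : reflections_prod Q (reflection a c) = reflection a (reflections_prod Q c).
  rewrite !reflectionE linearB linearZ /= (reflections_prod_orthogonal aQ).
  by rewrite dual_form_reflections_prod.
rewrite (reflectionK hg hh ra) IH //; first by case/andP: uQ.
by move=> c cQ; apply: QS; rewrite inE cQ orbT.
Qed.

Lemma reflections_prod_mem Q b : uniq Q -> {subset Q <= S} -> mutually_orthogonal Q ->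
  b \in Q -> reflections_prod Q b = - b.
Proof.
have [_ rS _] := hS; elim: Q b => [|a Q IH] // b uQ QS oQ.
have [oQ' aQ Qa] := mutually_orthogonal_cons uQ oQ.
have ra : is_root a by apply/rS/QS/mem_head.
rewrite reflections_prod_cons inE => /predU1P[->|bQ].
  by rewrite reflections_prod_orthogonal // reflection_id.
rewrite IH //; last 2 first.
- by case/andP: uQ.
- by move=> c cQ; apply: QS; rewrite inE cQ orbT.
by rewrite linearN /= reflection_orthogonal ?Qa.
Qed.

Lemma reflections_prod_positive Q b : uniq Q -> {subset Q <= S} ->
  mutually_orthogonal Q -> positive_roots S b -> b \notin Q ->
  positive_roots S (reflections_prod Q b).
Proof.
elim: Q b => [|a Q IH] b uQ QS oQ pb; first by rewrite reflections_prod_nil.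
have [oQ' aQ Qa] := mutually_orthogonal_cons uQ oQ.
have QS' : {subset Q <= S} by move=> c cQ; apply: QS; rewrite inE cQ orbT.
have uQ' : uniq Q by case/andP: uQ.
rewrite inE negb_or reflections_prod_cons => /andP[ba bQ].
apply: (reflection_positive hS); [exact/QS/mem_head|exact: IH|].
(* The product over [Q] is injective and fixes [a], so it cannot send [b] to [a]. *)
rewrite -[a in X in _ != X](reflections_prod_orthogonal aQ).
by rewrite (inj_eq (can_inj (reflections_prodK uQ' QS' oQ'))).
Qed.

End Orthogonal.

Lemma bipartite_inverse Q1 Q2 : simple_roots (Q1 ++ Q2) ->
  mutually_orthogonal Q1 -> mutually_orthogonal Q2 ->
  ((reflections_prod Q2 \o reflections_prod Q1)^-1 =
    reflections_prod Q1 \o reflections_prod Q2)%VF.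
Proof.
move=> hQ o1 o2; have [fQ _ _] := hQ.
have := free_uniq fQ; rewrite cat_uniq => /and3P[u1 _ u2].
have K1 := reflections_prodK hQ u1 (mem_subseq (prefix_subseq _ _)) o1.
have K2 := reflections_prodK hQ u2 (mem_subseq (suffix_subseq _ _)) o2.
set t1 := reflections_prod Q1 in K1 *; set t2 := reflections_prod Q2 in K2 *.
have inj : lker (t2 \o t1)%VF == 0%VS.
  by apply/lker0P => a b; rewrite !comp_lfunE => /(can_inj K2) /(can_inj K1).
apply/lfunP => b; rewrite -[b in LHS]K2 -[t2 b in LHS]K1 -[t2 _]comp_lfunE.
by rewrite lker0_lfunK // comp_lfunE.
Qed.

(** The inverse of t2 t1 is t1 t2. A positive [b] outside [Q2] stays positive under t2, and t1 then
    makes it negative exactly when t2 b lies in [Q1]. The second part appears as t(-a) = t2 a for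
    [a] in [Q1]. *)
Lemma Lambda_bipartite Q1 Q2 (t := (reflections_prod Q2 \o reflections_prod Q1)%VF) :
  simple_roots (Q1 ++ Q2) -> mutually_orthogonal Q1 -> mutually_orthogonal Q2 ->
  disjoint_union [set` Q2] [set t (- b) | b in [set` Q1]]
    (positive_roots (Q1 ++ Q2) `&`
     [set b | positive_roots (Q1 ++ Q2) (- (t^-1)%VF b)]).
Proof.
move=> hQ o1 o2; have [fQ _ _] := hQ; rewrite {}/t bipartite_inverse //.
have := free_uniq fQ; rewrite cat_uniq => /and3P[u1 /hasPn u12 u2].
have s1 := mem_subseq (prefix_subseq Q1 Q2).
have s2 := mem_subseq (suffix_subseq Q1 Q2).
have K1 := reflections_prodK hQ u1 s1 o1.
have K2 := reflections_prodK hQ u2 s2 o2.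
have N1 a : a \in Q1 -> reflections_prod Q1 a = - a.
  by move=> aQ; apply: (reflections_prod_mem hQ).
have N2 a : a \in Q2 -> reflections_prod Q2 a = - a.
  by move=> aQ; apply: (reflections_prod_mem hQ).
have P1 b := reflections_prod_positive hQ u1 s1 o1 (b := b).
have P2 b := reflections_prod_positive hQ u2 s2 o2 (b := b).
have pQ := simple_positive hQ.
set pos := positive_roots _ in P1 P2 pQ *.
set t1 := reflections_prod Q1 in K1 N1 P1 *; set t2 := reflections_prod Q2 in K2 N2 P2 *.
have tE a : a \in Q1 -> (t2 \o t1)%VF (- a) = t2 a.
  by move=> aQ; rewrite comp_lfunE linearN /= N1 // opprK.
split.
  apply/seteqP; split=> // b [/= bQ2 [a /= aQ1]]; rewrite tE // => ab.
  apply: (positive_opp hQ (pQ _ (s1 _ aQ1))).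
  by rewrite -[a]K2 ab N2 // opprK; apply/pQ/s2.
apply/seteqP; split=> b.
  move=> [pb /=]; rewrite comp_lfunE => nb.
  have [bQ2|bQ2] := boolP (b \in Q2); [by left|right].
  have pb2 := P2 _ pb bQ2.
  have [bQ1|bQ1] := boolP (t2 b \in Q1); last first.
    by case: (positive_opp hQ (P1 _ pb2 bQ1)).
  by exists (t2 b) => //; rewrite tE.
move=> [/= bQ2|[a /= aQ1 <-]].
  split; first exact/pQ/s2.
  rewrite /= comp_lfunE N2 // linearN opprK /=; apply: P1; first exact/pQ/s2.
  exact: u12.
rewrite tE //; split; last by rewrite /= comp_lfunE K2 N1 // opprK; apply/pQ/s1.
by apply: P2; [exact/pQ/s1|apply: contraL aQ1 => /u12].
Qed.

End SimpleRoots.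

(** * Rotation of clockwise labelled rays *)

(** The difference f(n) - n is nondecreasing, since [f] is strictly increasing, and periodic; so it
    is constant. Iterating [s] times from 0 identifies the constant as [k]. *)
Lemma increasing_shift (f : nat -> nat) (s k : nat) :
  (0 < s * k)%N -> {homo f : m n / (m < n)%N} ->
  (forall n, f (n + s * k) = f n + s * k)%N -> iter s f 0%N = (s * k)%N ->
  forall n, f n = (n + k)%N.
Proof.
move=> N0 fmono fper fs.
have fS n : (f n < f n.+1)%N by apply: fmono.
have fge n : (n <= f n)%N by elim: n => // n IH; apply: leq_ltn_trans (fS n).
have gmono m n : (m <= n)%N -> (f m - m <= f n - n)%N.
  elim: n => [|n IH]; first by rewrite leqn0 => /eqP ->.
  rewrite leq_eqVlt => /predU1P[-> //|/IH]; have := fS n; have := fge n; lia.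
have fperM m n : (f (n + m * (s * k)) = f n + m * (s * k))%N.
  by elim: m => [|m IH]; rewrite ?addn0 // mulSnr !addnA fper IH.
have gconst n : (f n - n = f 0 - 0)%N.
  have := gmono 0%N n (leq0n n); have /gmono : (n <= 0 + n * (s * k))%N.
    by rewrite add0n leq_pmulr.
  by rewrite fperM; lia.
have fE n : f n = (n + f 0)%N by have := gconst n; have := fge n; lia.
have itE j : iter j f 0%N = (j * f 0)%N by elim: j => // j IH; rewrite iterS fE IH; lia.
move: fs; rewrite itE => /eqP; rewrite eqn_pmul2l; last by case: (s) N0.
by move=> /eqP <-.
Qed.

Section Rays.
Variable R : realType.
Local Notation C := R[i].
Implicit Types (x y : R) (z w : C).

Lemma expiD x y : expi (x + y) = expi x * expi y.
Proof.
by apply/eqP; rewrite eq_complex /= cosD sinD [sin x * _ + _]addrC !eqxx.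
Qed.

Lemma expi0 : expi 0 = 1 :> C.
Proof. by rewrite /expi cos0 sin0. Qed.

Lemma expi_neq0 x : expi x != 0 :> C.
Proof.
apply/eqP => x0; have := expiD x (- x); rewrite subrr expi0 x0 mul0r => /eqP.
by rewrite oner_eq0.
Qed.

Lemma expi_2pi (k : int) : expi (2 * pi * k%:~R) = 1 :> C.
Proof.
have nat_case n : expi (2 * pi * n%:R) = 1 :> C.
  elim: n => [|n IH]; first by rewrite mulr0 expi0.
  rewrite -(natr1 n) (mulrDr (2 * pi)) mulr1 expiD IH mul1r /expi.
  by rewrite mulr_natl cos2pi sin2pi.
case: k => n; first exact: nat_case.
rewrite NegzE mulrNz mulrN -[LHS]mulr1 -(nat_case n.+1).
by rewrite -expiD addNr expi0.
Qed.

Lemma ray_mem z : ray z z.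
Proof. by exists 1 => //; rewrite rmorph1 mul1r. Qed.

Lemma ray_mul w z : ray (w * z) = [set w * u | u in ray z].
Proof.
apply/seteqP; split=> [_ [r r0 ->]|_ [_ [r r0 ->] <-]]; last by exists r => //; rewrite mulrCA.
by exists (real_complex R r * z); [exists r|rewrite mulrCA].
Qed.

Lemma ray_positive z w : z != 0 -> ray w z -> ray z = ray w.
Proof.
move=> z0 [r r0 zE]; have rn0 : r != 0.
  by apply: contraNneq z0 => r0'; rewrite zE r0' rmorph0 mul0r.
apply/seteqP; split=> [_ [q q0 ->]|_ [q q0 ->]].
  by exists (q * r); rewrite ?mulr_ge0 // rmorphM /= zE mulrA.
exists (q / r); first by rewrite mulr_ge0 ?invr_ge0.
by rewrite zE mulrA -rmorphM /= divfK.
Qed.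

Lemma expi_eq1 x : expi x = 1 :> C -> exists k : int, x = 2 * pi * k%:~R.
Proof.
move=> x1; have tp0 : 0 < 2 * pi :> R by rewrite mulr_gt0 // pi_gt0.
exists (Num.floor (x / (2 * pi))); set k := Num.floor _.
(* Half of the remainder lies in [0, pi), where the sine vanishes only at 0; cos 2y = 1 gives sin y
   = 0. *)
pose y := (x - 2 * pi * k%:~R) / 2.
have xE : x = 2 * pi * k%:~R + y *+ 2.
  by rewrite -[y *+ 2]mulr_natr divfK ?pnatr_eq0 // addrC subrK.
have y0 : 0 <= y.
  by rewrite divr_ge0 // subr_ge0 mulrC -ler_pdivlMr // floor_le.
have ypi : y < pi.
  rewrite ltr_pdivrMr // ltrBlDl [pi * 2]mulrC -[X in _ + X]mulr1 -mulrDr.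
  by rewrite mulrC -ltr_pdivrMr // -intrD1 floorD1_gt.
move: x1; rewrite xE expiD expi_2pi mul1r => -[+ _].
rewrite cos_mulr2n => cy; have cs := cos2Dsin2 y.
have /eqP : sin y ^+ 2 = 0 by lra.
rewrite sqrf_eq0 => /eqP sy.
move: y0; rewrite le_eqVlt => /predU1P[<-|y0]; first by rewrite mul0rn addr0.
by have := @sin_gt0_pi R y; rewrite y0 ypi sy ltxx => /(_ isT).
Qed.

Lemma ray_expi_inj x y : ray (expi x) = ray (expi y) ->
  exists k : int, x = y + 2 * pi * k%:~R.
Proof.
move=> xy; have [r r0 xE] : ray (expi y) (expi x) by rewrite -xy; apply: ray_mem.
(* Both points have modulus 1. *)
have r1 : r = 1.
  move: xE => [cE sE]; apply/eqP; rewrite -(sqrp_eq1 r0) -(cos2Dsin2 x) cE sE.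
  by rewrite !mul0r subr0 addr0 !exprMn -mulrDr cos2Dsin2 mulr1.
have [k kE] : exists k : int, x - y = 2 * pi * k%:~R.
  apply: expi_eq1; apply: (mulIf (expi_neq0 y)).
  by rewrite -expiD subrK xE r1 rmorph1.
by exists k; rewrite -kE addrC subrK.
Qed.

(** * Clockwise enumeration of the directions *)

Section Clockwise.
Variables (D : set (set C)) (s : nat) (d : nat -> set C) (theta : nat -> R).
Hypothesis s0 : (0 < s)%N.
Local Notation N := (2 * s)%N.
Hypothesis DE : D = d @` [set i | (1 <= i <= N)%N].
Hypothesis dE : forall i, (1 <= i <= N)%N -> d i = ray (expi (theta i)).
Hypothesis theta_decr :
  forall i j, (1 <= i)%N -> (i < j)%N -> (j <= N)%N -> theta j < theta i.
Hypothesis theta_turn : theta 1%N - theta N < 2 * pi.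

(* The angles of the directions met when turning clockwise from d_1 for ever. *)
Let T (n : nat) : R := theta (n %% N).+1 - 2 * pi * (n %/ N)%:R.

Let N0 : (0 < N)%N. Proof. by rewrite muln_gt0. Qed.

Let T_period n : T (n + N) = T n - 2 * pi.
Proof.
by rewrite /T modnDr divnDr // divnn N0 natrD mulrDr mulr1 opprD addrA.
Qed.

Let T_decr : {homo T : m n / (m < n)%N >-> n < m}.
Proof.
apply: (@homo_ltn _ T (fun x y : R => y < x)) => [y x z /[swap]|n]; first exact: lt_trans.
rewrite /T modnS divnS //; have lt_n := ltn_pmod n N0.
case: ifPn => [Nn|Nn] /=; last first.
  rewrite ltrD2r theta_decr // ltn_neqAle lt_n andbT.
  apply: contraNneq Nn => nN; rewrite /dvdn -addn1 -modnDml addn1 nN.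
  by rewrite modnn.
have nN : (n %% N).+1 = N.
  apply/eqP; rewrite eqn_leq lt_n /= dvdn_leq //.
  by rewrite /dvdn -addn1 modnDml addn1.
rewrite nN natrD mulrDr mulr1; move: theta_turn; lra.
Qed.

Let T_ray n : d (n %% N).+1 = ray (expi (T n)).
Proof.
rewrite dE ?ltn_pmod //; congr ray.
by rewrite /T -mulrN [(n %/ N)%:R]pmulrn -mulrNz expiD expi_2pi mulr1.
Qed.

Let T_dir n : D (ray (expi (T n))).
Proof. by rewrite -T_ray DE; exists (n %% N).+1; rewrite //= ltn_pmod. Qed.

Let T_le0 m : T m <= T 0.
Proof. by case: m => // m; apply/ltW/T_decr. Qed.

(** An angle of a direction differs from some [theta i] by a multiple of a full turn. The labels
    span less than one turn, so a positive multiple would exceed [T 0]. *)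
Let T_surj x : D (ray (expi x)) -> x <= T 0 -> exists n, T n = x.
Proof.
rewrite {1}DE => -[[//|i] /= iN]; rewrite dE // => /esym/ray_expi_inj[k ->{x}].
have -> : T 0 = theta 1 by rewrite /T mod0n div0n mulr0 subr0.
have theta_le1 : theta i.+1 <= theta 1.
  by case: (i) iN => // j jN; rewrite ltW // theta_decr.
have theta_geN : theta N <= theta i.+1.
  by move: iN; rewrite leq_eqVlt => /predU1P[->//|iN]; rewrite ltW // theta_decr.
have p0 := pi_gt0 R.
case: k => [[|k]|k] xle.
- by exists i; rewrite /T modn_small ?divn_small // !mulr0 subr0 addr0.
- have : 0 <= 2 * pi * k%:R :> R by rewrite mulr_ge0 ?mulr_ge0 // ltW.
  have kE : (Posz k.+1)%:~R = k%:R + 1 :> R by rewrite natr1.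
  by move: theta_turn xle; rewrite kE (mulrDr (2 * pi)) mulr1; lra.
exists (k.+1 * N + i)%N; rewrite /T modnMDl modn_small // divnMDl // divn_small //.
by rewrite addn0 NegzE mulrNz mulrN.
Qed.

Lemma direction_inj i j : (1 <= i <= N)%N -> (1 <= j <= N)%N -> d i = d j -> i = j.
Proof.
wlog lt_ij : i j / (i < j)%N.
  move=> W; have [lt|lt|->//] := ltngtP i j => iN jN dij; first exact: W.
  by apply/esym/W.
move=> iN jN; rewrite !dE // => /ray_expi_inj[k kE].
have [i1 _] := andP iN; have [_ jN'] := andP jN.
have ti : theta i <= theta 1%N.
  move: i1; rewrite leq_eqVlt => /predU1P[<-//|i1].
  by rewrite ltW // theta_decr //; case/andP: iN.
have tj : theta N <= theta j.
  move: jN'; rewrite leq_eqVlt => /predU1P[->//|jN'].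
  by rewrite ltW // theta_decr //; case/andP: jN.
have p0 := pi_gt0 R; have tij := theta_decr i1 lt_ij jN'; exfalso.
case: k kE => [[|k]|k] kE.
- by move: tij; rewrite kE mulr0 addr0 ltxx.
- have : 0 <= 2 * pi * k%:R :> R by rewrite mulr_ge0 ?mulr_ge0 // ltW.
  have E : (Posz k.+1)%:~R = k%:R + 1 :> R by rewrite natr1.
  by move: theta_turn kE; rewrite E (mulrDr (2 * pi)) mulr1; lra.
have : 0 <= 2 * pi * k.+1%:R :> R by rewrite mulr_ge0 ?mulr_ge0 // ltW.
by move: kE; rewrite NegzE mulrNz mulrN -pmulrn; lra.
Qed.

Lemma rotation_shift z n :
  (forall z, D (ray z) -> D (ray (expi (- (2 * pi / s%:R)) * z))) ->
  ray z = d (n %% N).+1 ->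
  ray (expi (- (2 * pi / s%:R)) * z) = d ((n + 2) %% N).+1.
Proof.
set rho := 2 * pi / s%:R => Drho zn.
have rayT m : ray (expi (- rho) * expi (T m)) = ray (expi (T m - rho)).
  by rewrite -expiD addrC.
(* The rotated angle belongs to a direction and stays below [T 0], so the enumeration reaches it. *)
have exf m : exists k, T k = T m - rho.
  apply: T_surj; first by rewrite -rayT; apply/Drho/T_dir.
  by rewrite (le_trans _ (T_le0 m)) // gerBl divr_ge0 ?mulr_ge0 ?pi_ge0.
have [f fE] := choice exf.
have Tmono m k : (T k < T m) = (m < k)%N.
  apply/idP/idP => [|/T_decr //]; apply: contraTT; rewrite -leqNgt -leNgt.
  by rewrite leq_eqVlt => /predU1P[->//|/T_decr /ltW].
have Tinj : injective T.
  by move=> m k mk; case: (ltngtP m k) => // /T_decr; rewrite mk ltxx.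
have -> : (n + 2 = f n)%N; last first.
  by rewrite T_ray fE -rayT !ray_mul zn T_ray.
symmetry; apply: (@increasing_shift f s 2).
- by rewrite mulnC.
- by move=> m k mk; rewrite -Tmono !fE ltrD2r Tmono.
- by move=> m; apply: Tinj; rewrite mulnC T_period !fE T_period addrAC.
(* After [s] rotations the angle has dropped by exactly one turn, which is 2s steps of the
   enumeration. *)
apply: Tinj; have itE j : T (iter j f 0%N) = T 0 - rho * j%:R.
  elim: j => [|j IH]; first by rewrite mulr0 subr0.
  by rewrite iterS fE IH -(natr1 j) mulrDr mulr1 opprD addrA.
rewrite itE /rho divfK ?pnatr_eq0 -?lt0n // mulnC -[(2 * s)%N]add0n T_period //.
Qed.

End Clockwise.
End Rays.

(** * The exponential of imaginary multiples *)

Section ComplexExp.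
Variable R : realType.
Local Notation C := R[i].
Implicit Types (x : R).

Lemma exp_coeff_imaginary x n :
  (n`!%:R : C)^-1 * Complex 0 x ^+ n = Complex (cos_coeff x n) (sin_coeff x n).
Proof.
have sq m : Complex 0 x ^+ m.*2 = real_complex R ((-1) ^+ m * x ^+ m.*2).
  rewrite -mul2n !exprM rmorphM !rmorphXn /= -exprMn; congr (_ ^+ _).
  by apply/eqP; rewrite expr2 eq_complex /=; apply/andP; split; apply/eqP; ring.
have -> : (n`!%:R : C)^-1 = real_complex R (n`!%:R^-1) by rewrite fmorphV rmorph_nat.
(* Even powers of ix are real and odd ones imaginary, matching the coefficients of cosine and
   sine. *)
have [m nE] : exists m, n = (odd n + m.*2)%N by exists n./2; rewrite odd_double_half.
rewrite /cos_coeff /sin_coeff /=; case: (odd n) nE => -> /=; rewrite ?add1n ?add0n.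
  rewrite exprS sq /= doubleK /exprz; apply/eqP; rewrite eq_complex /=.
  rewrite exprS !(mul0r, mulr0, subr0, add0r, addr0, mul1r, oppr0) eqxx /=.
  by apply/eqP; rewrite [LHS]mulrC (mulrCA x).
rewrite sq doubleK; apply/eqP; rewrite eq_complex /=.
rewrite !(mul0r, mulr0, subr0, add0r, addr0, mul1r, oppr0) eqxx andbT.
by apply/eqP; rewrite [LHS]mulrC.
Qed.

Lemma normc_le (z : C) : `|z| <= real_complex R (`|complex.Re z| + `|complex.Im z|).
Proof.
have normR (r : R) : `|real_complex R r| = real_complex R `|r|.
  by rewrite normc_def /= expr0n /= addr0 sqrtr_sqr.
rewrite {1}[z]complexE; apply: le_trans (ler_normD _ _) _.
rewrite normrM !normR rmorphD /= normc_def /= expr0n expr1n add0r sqrtr1 mul1r.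
exact: lexx.
Qed.

Lemma cvg_complex (u : nat -> C) (l : C) :
  (fun n => complex.Re (u n)) @ \oo --> complex.Re l ->
  (fun n => complex.Im (u n)) @ \oo --> complex.Im l ->
  (u : nat -> C^o) @ \oo --> (l : C^o).
Proof.
move=> /cvgrPdist_lt re /cvgrPdist_lt im; apply/cvgrPdist_lt => e e0.
have [e' e'E] : exists e', e = real_complex R e' by apply/complex_realP/gtr0_real.
move: e0; rewrite e'E ltcR => e'0; have e2 : 0 < e' / 2 by rewrite divr_gt0.
near=> n; apply: le_lt_trans (normc_le _) _; rewrite ltcR.
have -> : complex.Re (l - u n) = complex.Re l - complex.Re (u n).
  by case: (l) (u n) => a b [].
have -> : complex.Im (l - u n) = complex.Im l - complex.Im (u n).
  by case: (l) (u n) => a b [].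
rewrite [ltRHS]splitr; apply: ltrD; near: n; [exact: re|exact: im].
Unshelve. all: by end_near.
Qed.

Lemma cvg_exp_imaginary x :
  ((fun n => \sum_(k < n) (k`!%:R : C)^-1 * Complex 0 x ^+ k) : nat -> C^o) @ \oo
    --> (expi x : C^o).
Proof.
have E n : \sum_(k < n) (k`!%:R : C)^-1 * Complex 0 x ^+ k =
    Complex (series (cos_coeff x) n) (series (sin_coeff x) n).
  rewrite /series /= !big_mkord; elim: n => [|n IH]; first by rewrite !big_ord0.
  by rewrite !big_ord_recr /= IH exp_coeff_imaginary.
apply: cvg_complex; under eq_fun do rewrite E /=.
  suff : series (cos_coeff x) @ \oo --> cos x by [].
  by rewrite unlock; exact: is_cvg_series_cos_coeff.
suff : series (sin_coeff x) @ \oo --> sin x by [].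
by rewrite unlock; exact: is_cvg_series_sin_coeff.
Qed.

(** On an eigenvector the partial sums are scalar partial sums of exp(ix) times [v]. Uniqueness of
    limits gives equality under every functional, and coordinates suffice to conclude. *)
Lemma is_lfun_exp_eigen (V : vectType C) (f F : 'End(V)) x v :
  is_lfun_exp f F -> f v = Complex 0 x *: v -> F v = expi x *: v.
Proof.
move=> fF fv.
have phiE (phi : 'Hom(V, C^o)) : phi (F v) = phi (expi x *: v).
  have := fF phi v.
  have it k : iter k f v = Complex 0 x ^+ k *: v.
    elim: k => [|k IH]; first by rewrite scale1r.
    by rewrite iterS IH linearZ /= fv scalerA exprSr.
  have E n : phi (\sum_(k < n) (k`!%:R : C)^-1 *: iter k f v) =
      phi v * (\sum_(k < n) (k`!%:R : C)^-1 * Complex 0 x ^+ k).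
    rewrite linear_sum mulr_sumr; apply: eq_bigr => k _.
    by rewrite it scalerA linearZ; exact: mulrC.
  under eq_fun do rewrite E.
  have lim : (fun n => phi v * (\sum_(k < n) (k`!%:R : C)^-1 * Complex 0 x ^+ k) : C^o)
      @ \oo --> (phi v * expi x : C^o).
    by apply: cvgMl_tmp; exact: cvg_exp_imaginary.
  move=> /(norm_cvg_unique lim) <-; rewrite linearZ /=; exact: mulrC.
have bP := vbasisP {:V}.
rewrite (coord_basis bP (memvf (F v))) (coord_basis bP (memvf (expi x *: v))).
apply: eq_bigr => i _; congr (_ *: _).
by have := phiE (linfun (coord (vbasis {:V}) i : V -> C^o)); rewrite !lfunE.
Qed.

End ComplexExp.

(** * Singular directions *)

Lemma LambdaE (R : realType) (g : lieAlgebra R[i]) (h : {vspace g})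
    (P : set (dual_space h)) (t : 'End(dual_space h)) :
  Lambda P t = P `&` [set b | P (- t b)].
Proof.
apply/seteqP; split=> b [].
  by move=> [c Pc /= cE] Pb; split=> //=; rewrite -cE opprK.
by move=> Pb /= Ptb; split=> //; exists (- t b); rewrite ?opprK.
Qed.

Section Regular.
Variables (K : numFieldType) (g : lieAlgebra K) (h : {vspace g}) (E : g).
Hypothesis hh : cartan_subalgebra h.
Hypothesis hcent : forall X : g, (X \in h) = (ad E X == 0).

Lemma regular_mem : E \in h.
Proof. by rewrite hcent ad_alternating. Qed.

(** If [b] vanished at [E], its root vectors would centralize [E], so lie in [h] and have weight
    zero. *)
Lemma root_regular_neq0 (b : dual_space h) : is_root b -> b (vsproj h (- E)) != 0.
Proof.
move=> [b0 [X X0 bX]]; apply: contra_neq b0; rewrite !linearN => /eqP.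
rewrite oppr_eq0 => /eqP bE; apply: (in_root_space_inj X0 bX).
apply/(in_root_space0 hh); rewrite hcent.
by rewrite -(vsprojK regular_mem) bX bE scale0r.
Qed.

End Regular.

(** * The adjoint action on the centralizer of a cyclic element *)

Section Adjoint.
Variables (R : realType) (g : lieAlgebra R[i]) (G : lieGroup g).
Variables (h : {vspace g}) (E : g) (x : G) (z : R[i]).
Hypothesis hcent : forall X : g, (X \in h) = (ad E X == 0).
Hypothesis z0 : z != 0.
Hypothesis xE : Ad x E = z *: E.

Lemma AdK : cancel (Ad x) (Ad (x^-1)%g).
Proof. by move=> X; rewrite -comp_lfunE -AdM mulVg Ad1 id_lfunE. Qed.

Lemma Ad_centralizer X : X \in h -> Ad x X \in h.
Proof.
rewrite !hcent => /eqP EX; have := Ad_bracket x E X; rewrite EX linear0 xE.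
rewrite linearZ /= scale_lfunE => /esym/eqP.
by rewrite scaler_eq0 (negPf z0).
Qed.

(** The dual action precomposes with the inverse, and [E] is an eigenvector for [z]; hence the
    factor [z^-1], which reverses the sense of rotation. *)
Lemma dual_action_regular (b : dual_space h) :
  dual_action (lfun_restr h (Ad x)) b (vsproj h (- E)) = z^-1 * b (vsproj h (- E)).
Proof.
have tE H : lfun_restr h (Ad x) H = vsproj h (Ad x (vsval H)).
  by rewrite linfunE // => c A B; rewrite !linearP.
have tinj : lker (lfun_restr h (Ad x)) == 0%VS.
  apply/lker0P => A B; rewrite !tE => /(congr1 vsval).
  rewrite !vsprojK ?Ad_centralizer ?subvsP //.
  by move=> /(can_inj AdK) /val_inj.
have Eh := regular_mem hcent.
have [H HE] : exists H, H = z^-1 *: vsproj h (- E) by eexists.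
have tH : lfun_restr h (Ad x) H = vsproj h (- E).
  rewrite tE; congr (vsproj h _).
  have -> : vsval H = - (z^-1 *: E).
    by rewrite HE linearZ /= vsprojK ?memvN // scalerN.
  by rewrite linearN linearZ /= xE scalerA mulVf // scale1r.
by rewrite /dual_action comp_lfunE -[in LHS]tH lker0_lfunK // HE linearZ.
Qed.

End Adjoint.

(** * Roots changing sign, read off from their directions *)

Section Directions.
Variables (R : realType) (g : lieAlgebra R[i]) (h : {vspace g}) (E : g).
Variables (s : nat) (d : nat -> set R[i]).
Variables (pos : set (dual_space h)) (gamma : 'End(dual_space h)).
Local Notation v := (vsproj h (- E)).
Hypothesis s1 : (1 < s)%N.
Hypothesis regular : forall b : dual_space h, is_root b -> b v != 0.
Hypothesis hd : clockwise_labelling (singular_directions h E) (2 * s) d.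
Hypothesis posE : pos = \bigcup_(i in [set i : nat | (1 <= i <= s)%N]) roots_on h E (d i).
Hypothesis pos_opp : forall b, is_root b -> pos (- b) <-> ~ pos b.
Hypothesis gamma_root : forall b, is_root b -> is_root (gamma b).
Hypothesis gammaV_root : forall b, is_root b -> is_root ((gamma^-1)%VF b).
Hypothesis gammaVK : cancel (gamma^-1)%VF gamma.
Hypothesis gamma_rot : forall b : dual_space h,
  gamma b v = expi (- (2 * pi / s%:R)) * b v.

(** Indices start at 0, for arithmetic modulo 2s. Equality of rays replaces membership, which is
    equivalent since roots do not vanish at -E. *)
Let on (b : dual_space h) n := ray (b v) = d n.+1.

Let roots_onP b n : (n < 2 * s)%N -> roots_on h E (d n.+1) b <-> is_root b /\ on b n.
Proof.
have [theta [_ dE _ _]] := hd; move=> nN; rewrite /on; split=> -[rb bn]; split=> //.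
  by move: bn; rewrite dE // => bn; apply: ray_positive (regular rb) bn.
by rewrite -bn; apply: ray_mem.
Qed.

Let on_ex b : is_root b -> exists2 n, (n < 2 * s)%N & on b n.
Proof.
have [theta [DE _ _ _]] := hd => rb.
have : singular_directions h E (ray (b v)) by exists b.
by rewrite DE => -[[|n] // nN dn]; exists n.
Qed.

Let on_inj b m n : (m < 2 * s)%N -> (n < 2 * s)%N -> on b m -> on b n -> m = n.
Proof.
have [theta [DE dE decr turn]] := hd => mN nN bm bn; apply: succn_inj.
have s0 : (0 < s)%N by apply: ltnW.
by apply: (direction_inj dE decr turn) => //; rewrite -bm -bn.
Qed.

Let on_gamma b n : (n < 2 * s)%N -> on b n -> on (gamma b) ((n + 2) %% (2 * s)).
Proof.
have [theta [DE dE decr turn]] := hd => nN bn; rewrite /on gamma_rot.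
apply: (rotation_shift (ltnW s1) DE dE decr turn); last by rewrite modn_small.
move=> z [c rc cz]; rewrite ray_mul -cz -ray_mul -gamma_rot.
by exists (gamma c) => //; apply: gamma_root.
Qed.

Let posP b n : (n < 2 * s)%N -> is_root b -> on b n -> pos b <-> (n < s)%N.
Proof.
move=> nN rb bn; rewrite posE; split=> [[[|m] //= ms]|ns].
  have mN : (m < 2 * s)%N by lia.
  by move=> /(roots_onP _ mN)[_ bm]; rewrite (on_inj nN mN bn bm).
by exists n.+1; rewrite //; apply/roots_onP.
Qed.

(** If the inverse image of [b] has index m, then [b] has index m + 2 modulo 2s. Positive means
    index below [s], so a sign change requires wrapping around, that is, index 0 or 1. *)
Lemma directions_Lambda_inverse :
  disjoint_union (roots_on h E (d 1%N)) (roots_on h E (d 2%N)) (Lambda pos (gamma^-1)%VF).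
Proof.
have N0 : (0 < 2 * s)%N by lia.
have N1 : (1 < 2 * s)%N by lia.
split.
  apply/seteqP; split=> // b [/(roots_onP _ N0)[_ b0] /(roots_onP _ N1)[_ b1]].
  by have := on_inj N0 N1 b0 b1.
have root_pos b : pos b -> is_root b by rewrite posE => -[i _ []].
rewrite LambdaE; apply/seteqP; split=> b.
  move=> [pb /=]; have rb := root_pos _ pb; have rc := gammaV_root rb.
  move=> /(pos_opp rc); have [m mN cm] := on_ex rc.
  move=> /(posP mN rc cm)/negP; rewrite -leqNgt => sm.
  have := on_gamma mN cm; rewrite gammaVK; set n := ((m + 2) %% _)%N => bn.
  have nN : (n < 2 * s)%N by rewrite ltn_pmod.
  have ns := (posP nN rb bn).1 pb.
  have [n0|n1] : n = 0%N \/ n = 1%N.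
    have [lt|ge] := ltnP (m + 2)%N (2 * s)%N.
      by move: ns; rewrite /n modn_small //; lia.
    by rewrite /n -(subnK ge) modnDr modn_small; lia.
  - by left; apply/(roots_onP _ N0); split=> //; rewrite -n0.
  - by right; apply/(roots_onP _ N1); split=> //; rewrite -n1.
have H n : (n < 2)%N -> roots_on h E (d n.+1) b ->
    (pos `&` [set b | pos (- (gamma^-1)%VF b)]) b.
  move=> n2; have nN : (n < 2 * s)%N by lia.
  move=> /(roots_onP _ nN)[rb bn]; have rc := gammaV_root rb.
  split; first by apply/(posP nN rb bn); lia.
  apply/(pos_opp rc); have [m mN cm] := on_ex rc.
  move=> /(posP mN rc cm) ms; have := on_gamma mN cm; rewrite gammaVK.
  rewrite modn_small; last by lia.
  move=> bm; have mN' : (m + 2 < 2 * s)%N by lia.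
  by have := on_inj nN mN' bn bm; lia.
by case; apply: H.
Qed.

(** A positive root of index n < s moves to n + 2 without wrapping, since s >= 2; it becomes
    negative exactly when n is s - 2 or s - 1. *)
Lemma directions_Lambda :
  disjoint_union (roots_on h E (d (s - 1)%N)) (roots_on h E (d s)) (Lambda pos gamma).
Proof.
have [s' sE] : exists s', s = s'.+2 by exists s.-2; lia.
have -> : (s - 1 = s'.+1)%N by lia.
have -> : d s = d s'.+2 by rewrite sE.
have N0 : (s' < 2 * s)%N by lia.
have N1 : (s'.+1 < 2 * s)%N by lia.
split.
  apply/seteqP; split=> // b [/(roots_onP _ N0)[_ b0] /(roots_onP _ N1)[_ b1]].
  by have := on_inj N0 N1 b0 b1; lia.
have root_pos b : pos b -> is_root b by rewrite posE => -[i _ []].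
have key b n : is_root b -> on b n -> (n < s)%N -> pos (- gamma b) <-> (s <= n + 2)%N.
  move=> rb bn ns; have rc := gamma_root rb; have nN0 : (n < 2 * s)%N by lia.
  have := on_gamma nN0 bn; rewrite modn_small; last by lia.
  have nN : (n + 2 < 2 * s)%N by lia.
  move=> cn; rewrite (pos_opp rc) (posP nN rc cn); split=> [/negP|le].
    by rewrite -leqNgt.
  by apply/negP; rewrite -leqNgt.
rewrite LambdaE; apply/seteqP; split=> b.
  move=> [pb /=]; have rb := root_pos _ pb; have [n nN bn] := on_ex rb.
  have ns := (posP nN rb bn).1 pb; move=> /(key b n rb bn ns) sn.
  have [n0|n1] : n = s' \/ n = s'.+1 by lia.
  - by left; apply/(roots_onP _ N0); split=> //; rewrite -n0.
  - by right; apply/(roots_onP _ N1); split=> //; rewrite -n1.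
have H n : (s' <= n)%N -> (n < s)%N -> roots_on h E (d n.+1) b ->
    (pos `&` [set b | pos (- gamma b)]) b.
  move=> s'n ns; have nN : (n < 2 * s)%N by lia.
  move=> /(roots_onP _ nN)[rb bn]; split; first exact/(posP nN rb bn).
  by apply/(key b n rb bn ns); lia.
by case; apply: H; lia.
Qed.

End Directions.

Lemma reflections_prod_root (K : numFieldType) (g : lieAlgebra K) (h : {vspace g}) :
  lie_simple g -> cartan_subalgebra h ->
  forall (Q : seq (dual_space h)) b, {in Q, forall a, is_root a} -> is_root b ->
  is_root (reflections_prod Q b).
Proof.
move=> hg hh; elim=> [|a Q IH] b rQ rb; first by rewrite reflections_prod_nil.
rewrite reflections_prod_cons; apply: (reflection_root hg hh); first exact/rQ/mem_head.
by apply: IH => // c cQ; apply: rQ; rewrite inE cQ orbT.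
Qed.

(* All roots alpha_0, ..., alpha_l take the value 1 at x_0, modulo s. *)
Lemma Ad_cyclic_element (R : realType) (g : lieAlgebra R[i]) (G : lieGroup g)
    (h : {vspace g}) (l : nat) (alpha : l.-tuple (dual_space h)) (psi : dual_space h)
    (q : 'I_l -> nat) (e : 'I_l.+1 -> g) (eps : 'I_l -> subvs_of h) (c : 'I_l.+1 -> R[i]) :
  psi = \sum_(i < l) tnth alpha i *+ q i ->
  (forall i, in_root_space (extended_roots alpha psi i) (e i)) ->
  (forall i j, tnth alpha i (eps j) = (i == j)%:R) ->
  let s := coxeter_number q in
  let x0 := \sum_(i < l) vsval (eps i) in
  let E := \sum_(i < l.+1) c i *: e i in
  Ad (lie_exp (Complex 0 (2 * pi / s%:R) *: x0) : G) E = expi (2 * pi / s%:R) *: E.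
Proof.
move=> hq he heps s x0 E.
have s0 : s%:R != 0 :> R by rewrite pnatr_eq0 /s /coxeter_number add1n.
pose H0 := \sum_(i < l) eps i.
have x0E : x0 = vsval H0 by rewrite /x0 /H0 linear_sum.
clearbody x0.
have aH0 j : tnth alpha j H0 = 1.
  rewrite /H0 linear_sum (bigD1 j) //= heps eqxx big1 ?addr0 // => i /negPf ij.
  by rewrite heps eq_sym ij.
have psiH0 : psi H0 = s%:R - 1.
  rewrite hq sum_lfunE /s /coxeter_number natrD addrC addKr natr_sum.
  apply: eq_bigr => i _; rewrite -[tnth _ _ *+ _]scaler_nat scale_lfunE aH0.
  exact: mulr1.
rewrite /E linear_sum scaler_sumr; apply: eq_bigr => i _; rewrite linearZ /=.
rewrite scalerA [_ * c i]mulrC -scalerA; congr (_ *: _).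
have exE x :
      Complex 0 (2 * pi / s%:R) * extended_roots alpha psi i H0 = Complex 0 x ->
    Ad (lie_exp (Complex 0 (2 * pi / s%:R) *: x0) : G) (e i) = expi x *: e i.
  move=> xE; apply: (@is_lfun_exp_eigen _ _ _ _ _ _ (@Ad_exp _ _ _ _)).
  by rewrite linearZ /= scale_lfunE x0E he scalerA xE.
rewrite /extended_roots in exE; case: (unlift ord0 i) exE => [j|] exE.
  by apply: exE; rewrite aH0 mulr1.
(* The remaining case is alpha_0, with value 1 - s at x_0: its angle is one full turn short of 2 pi
   / s. *)
rewrite (exE (2 * pi / s%:R - 2 * pi)).
  have <- : 2 * pi * (-1)%:~R = - (2 * pi) :> R by rewrite mulrN1z mulrN1.
  by rewrite expiD expi_2pi mulr1.
rewrite opp_lfunE psiH0 opprB.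
have -> : 1 - s%:R = real_complex R (1 - s%:R) by rewrite rmorphB rmorph1 rmorph_nat.
apply/eqP; rewrite eq_complex /= !(mul0r, mulr0, subr0, add0r, oppr0) eqxx /=.
by rewrite mulrBr mulr1 divfK.
Qed.

Lemma coxeter_number_gt1 (V : zmodType) (l : nat) (alpha : l.-tuple V) (q : 'I_l -> nat) :
  \sum_(i < l) tnth alpha i *+ q i != 0 -> (1 < coxeter_number q)%N.
Proof.
apply: contraNltn; rewrite /coxeter_number add1n ltnS leqn0 sum_nat_eq0.
by move=> /forallP q0; rewrite big1 // => i _; rewrite (eqP (q0 i)).
Qed.

(** * The two descriptions combined *)

Theorem corollary5p6
  (R : realType) (g : lieAlgebra R[i]) (G : lieGroup g)
  (hg : lie_simple g)
  (* h, simple roots, highest root *)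
  (h : {vspace g}) (hh : cartan_subalgebra h)
  (l : nat) (hrank : \dim h = l) (hl : (1 < l)%N)
  (alpha : l.-tuple (dual_space h)) (halpha : simple_roots alpha)
  (psi : dual_space h) (hpsi : highest_root alpha psi)
  (q : 'I_l -> nat) (hq : psi = \sum_(i < l) tnth alpha i *+ q i)
  (* root vectors for alpha_0, ..., alpha_l *)
  (e : 'I_l.+1 -> g)
  (he : forall i, e i != 0 /\ in_root_space (extended_roots alpha psi i) (e i))
  (* epsilon_j, x_0, P_0 *)
  (eps : 'I_l -> subvs_of h)
  (heps : forall i j, tnth alpha i (eps j) = (i == j)%:R)
  (s : nat) (hs : s = coxeter_number q)
  (x0 : g) (hx0 : x0 = \sum_(i < l) vsval (eps i))
  (P0 : G) (hP0 : P0 = lie_exp (Complex 0 (2 * pi / s%:R) *: x0))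
  (* E_+ and its centralizer h' *)
  (c : 'I_l.+1 -> R[i]) (hc : forall i, c i != 0)
  (E : g) (hE : E = \sum_(i < l.+1) c i *: e i)
  (h' : {vspace g}) (hh' : cartan_subalgebra h')
  (hcent : forall X : g, (X \in h') = (ad E X == 0))
  (* simple roots Pi' = Pi1 U Pi2 of Delta' and bipartite Coxeter element *)
  (Pi1 Pi2 : seq (dual_space h'))
  (hPi : simple_roots (Pi1 ++ Pi2))
  (hPi1 : mutually_orthogonal Pi1) (hPi2 : mutually_orthogonal Pi2)
  (gamma : 'End(dual_space h'))
  (hgamma : gamma = (reflections_prod Pi2 \o reflections_prod Pi1)%VF)
  (hgammadelta : forall b : dual_space h',
     gamma b = dual_action (lfun_restr h' (Ad P0)) b)
  (* singular directions *)
  (d : nat -> set R[i])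
  (hd : clockwise_labelling (singular_directions h' E) (2 * s) d)
  (hpos : positive_roots (Pi1 ++ Pi2) =
     \bigcup_(i in [set i : nat | (1 <= i <= s)%N]) roots_on h' E (d i)) :
  let pos := positive_roots (Pi1 ++ Pi2) in
  (disjoint_union (roots_on h' E (d 1%N)) (roots_on h' E (d 2%N))
     (Lambda pos (gamma^-1)%VF) /\
   disjoint_union [set` Pi2] [set gamma (- b) | b in [set` Pi1]]
     (Lambda pos (gamma^-1)%VF)) /\
  (disjoint_union (roots_on h' E (d (s - 1)%N)) (roots_on h' E (d s))
     (Lambda pos gamma) /\
   disjoint_union [set` Pi1] [set (gamma^-1)%VF (- b) | b in [set` Pi2]]
     (Lambda pos gamma)).
Proof.
move=> pos.
have s1 : (1 < s)%N.
  rewrite hs; apply: (coxeter_number_gt1 (alpha := alpha)).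
  by rewrite -hq; case: hpsi => -[].
have P0E : Ad P0 E = expi (2 * pi / s%:R) *: E.
  rewrite hP0 hx0 hE hs; apply: (Ad_cyclic_element _ _ hq) => // i.
  by case: (he i).
have [fPi rPi _] := hPi.
have s1P := mem_subseq (prefix_subseq Pi1 Pi2).
have s2P := mem_subseq (suffix_subseq Pi1 Pi2).
have gammaVE : (gamma^-1 = reflections_prod Pi1 \o reflections_prod Pi2)%VF.
  by rewrite hgamma; apply: bipartite_inverse.
have r1 b : is_root b -> is_root (reflections_prod Pi1 b).
  by apply: reflections_prod_root => // a /s1P /rPi.
have r2 b : is_root b -> is_root (reflections_prod Pi2 b).
  by apply: reflections_prod_root => // a /s2P /rPi.
have perm21 : perm_eq (Pi2 ++ Pi1) (Pi1 ++ Pi2) by rewrite perm_catC.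
have hPi' : simple_roots (Pi2 ++ Pi1).
  by apply: simple_roots_perm hPi; rewrite perm_catC.
have gammaE : ((gamma^-1)^-1 = gamma)%VF.
  by rewrite gammaVE (bipartite_inverse hg hh' hPi').
have gammaVK : cancel (gamma^-1)%VF gamma.
  have [u1 u2] : uniq Pi1 /\ uniq Pi2.
    by have := free_uniq fPi; rewrite cat_uniq => /and3P[].
  move=> b; rewrite gammaVE hgamma !comp_lfunE.
  by rewrite (reflections_prodK hg hh' hPi) // (reflections_prodK hg hh' hPi).
have pos_opp b : is_root b -> pos (- b) <-> ~ pos b.
  move=> rb; split=> [pNb pb|npb]; first exact: (positive_opp hPi) pb pNb.
  by case: (root_positive_or hg hh' hPi rb).
have gamma_rot (b : dual_space h') :
    gamma b (vsproj h' (- E)) = expi (- (2 * pi / s%:R)) * b (vsproj h' (- E)).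
  rewrite hgammadelta (dual_action_regular hcent (expi_neq0 _) P0E).
  congr (_ * _); apply: (mulIf (expi_neq0 (2 * pi / s%:R))).
  by rewrite mulVf ?expi_neq0 // -expiD addNr expi0.
have regular := root_regular_neq0 hh' hcent.
have gamma_root b : is_root b -> is_root (gamma b).
  by rewrite hgamma comp_lfunE => /r1 /r2.
have gammaV_root b : is_root b -> is_root ((gamma^-1)%VF b).
  by rewrite gammaVE comp_lfunE => /r2 /r1.
split; split.
- exact: directions_Lambda_inverse s1 regular hd hpos pos_opp
    gamma_root gammaV_root gammaVK gamma_rot.
- rewrite LambdaE hgamma; exact: Lambda_bipartite.
- exact: directions_Lambda s1 regular hd hpos pos_opp gamma_root gamma_rot.
(* Exchanging the two parts replaces gamma by its inverse, so the description by simple roots in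
   (ii) is the one in (i) for the exchanged parts. *)
have := Lambda_bipartite hg hh' hPi' hPi2 hPi1.
by rewrite (positive_roots_perm perm21) LambdaE -gammaVE gammaE.
Qed.
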